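(* Let $(X_1,Y_1),\ldots,(X_n,Y_n)$, $n\ge 2$, be i.i.d. copies of a random pair $(X,Y)$ with distribution $P$ on $\mathcal{X}\times\mathbb{R}$, where $Y$ is square integrable. Let $\varphi_1,\ldots,\varphi_d:\mathcal{X}\to\mathbb{R}$ be square integrable functions (with respect to the law of $X$), $\varphi(x)=(\varphi_1(x),\ldots,\varphi_d(x))^T$, and for $\theta\in\mathbb{R}^d$ let $f_\theta(x)=\langle\theta,\varphi(x)\rangle$. Let $\Theta\subseteq\mathbb{R}^d$ be a closed convex set (possibly $\Theta=\mathbb{R}^d$) and $\lambda\ge 0$. Let $R(f)=\mathbb{E}\{[Y-f(X)]^2\}$, $r(f)=\frac1n\sum_{i=1}^n[f(X_i)-Y_i]^2$, let $\hat\theta^{(\mathrm{ridge})}\in\arg\min_{\theta\in\Theta}\{r(f_\theta)+\lambda\|\theta\|^2\}$ and $\hat f^{(\mathrm{ridge})}=f_{\hat\theta^{(\mathrm{ridge})}}$, and let $\tilde\theta\in\arg\min_{\theta\in\Theta}\{R(f_\theta)+\lambda\|\theta\|^2\}$ and $\tilde f=f_{\tilde\theta}$. Assume $$\mathbb{E}[\|\varphi(X)\|^4]<+\infty\quad\text{and}\quad\mathbb{E}\{\|\varphi(X)\|^2[\tilde f(X)-Y]^2\}<+\infty.$$ Let $Q=\mathbb{E}[\varphi(X)\varphi(X)^T]$ with eigenvalues $\nu_1\ge\cdots\ge\nu_d$, let $Q_\lambda=Q+\lambda I$, and define the effective ridge dimension $$D=\sum_{i=1}^d\frac{\nu_i}{\nu_i+\lambda}\mathbb{1}(\nu_i>0)=\mathbb{E}[\|Q_\lambda^{-1/2}\varphi(X)\|^2].$$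 Then for any $\varepsilon>0$ there exists $n_\varepsilon$ such that for any $n\ge n_\varepsilon$, with probability at least $1-\varepsilon$, $$R(\hat f^{(\mathrm{ridge})})+\lambda\|\hat\theta^{(\mathrm{ridge})}\|^2\le\min_{\theta\in\Theta}\{R(f_\theta)+\lambda\|\theta\|^2\}+\frac{30\,\mathbb{E}\{\|Q_\lambda^{-1/2}\varphi(X)\|^2[\tilde f(X)-Y]^2\}}{\mathbb{E}\{\|Q_\lambda^{-1/2}\varphi(X)\|^2\}}\frac{D}{n}+1000\sup_{v\in\mathbb{R}^d}\frac{\mathbb{E}[\langle v,\varphi(X)\rangle^2[\tilde f(X)-Y]^2]}{\mathbb{E}(\langle v,\varphi(X)\rangle^2)+\lambda\|v\|^2}\frac{\log(3\varepsilon^{-1})}{n}$$ $$\le\min_{\theta\in\Theta}\{R(f_\theta)+\lambda\|\theta\|^2\}+\operatorname{ess\,sup}\mathbb{E}\{[Y-\tilde f(X)]^2\mid X\}\,\frac{30D+1000\log(3\varepsilon^{-1})}{n}.$$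
   Context: $\|\cdot\|$ and $\langle\cdot,\cdot\rangle$ denote the Euclidean norm and inner product on $\mathbb{R}^d$; $I$ is the $d\times d$ identity matrix. When $\lambda=0$, $D$ equals the rank of $Q$. *)

(* Defs.v *)
From HB Require Import structures.
From mathcomp Require Import all_boot all_order all_algebra.
From mathcomp Require Import all_classical all_reals all_analysis.
From mathcomp Require Import measurable_realfun.
Set Implicit Arguments. Unset Strict Implicit. Unset Printing Implicit Defensive.
Import Order.TTheory GRing.Theory Num.Def Num.Theory.
Import numFieldNormedType.Exports.
Local Open Scope classical_set_scope.
Local Open Scope ring_scope.

Definition dotv (R : realType) (d : nat) (u v : 'rV[R]_d) : R :=
  \sum_(i < d) u 0 i * v 0 i.
Definition sqnorm (R : realType) (d : nat) (u : 'rV[R]_d) : R := dotv u u.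

(* expectation (real-valued; used only for integrable quantities) *)
Definition expect (R : realType) (dT : measure_display) (T : measurableType dT)
  (mu : {measure set T -> \bar R}) (h : T -> R) : R :=
  fine (\int[mu]_z (h z)%:E).

Definition f_lin (R : realType) (d : nat) (dX : measure_display)
  (X : measurableType dX) (phi : X -> 'rV[R]_d) (theta : 'rV[R]_d) (x : X) : R :=
  dotv theta (phi x).

Definition pop_obj (R : realType) (d : nat) (dX : measure_display)
  (X : measurableType dX) (P : probability (X * R)%type R)
  (phi : X -> 'rV[R]_d) (lam : R) (theta : 'rV[R]_d) : R :=
  expect P (fun z => (z.2 - f_lin phi theta z.1) ^+ 2) + lam * sqnorm theta.

Definition emp_obj (R : realType) (d : nat) (dX : measure_display)
  (X : measurableType dX) (n : nat) (s : 'I_n -> (X * R)%type)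
  (phi : X -> 'rV[R]_d) (lam : R) (theta : 'rV[R]_d) : R :=
  n%:R^-1 * (\sum_(i < n) (f_lin phi theta (s i).1 - (s i).2) ^+ 2)
  + lam * sqnorm theta.

Definition Qmat (R : realType) (d : nat) (dX : measure_display)
  (X : measurableType dX) (P : probability (X * R)%type R)
  (phi : X -> 'rV[R]_d) : 'M[R]_d :=
  \matrix_(i, j) expect P (fun z => phi z.1 0 i * phi z.1 0 j).

Definition spectral_decomp (R : realType) (d : nat) (Q U : 'M[R]_d)
  (nu : 'rV[R]_d) : Prop :=
  U *m U^T = 1%:M /\ Q = U^T *m diag_mx nu *m U /\
  (forall i j : 'I_d, (i <= j)%N -> nu 0 j <= nu 0 i).

(* Q_lambda^{-1/2} = U^T diag((nu_i + lambda)^{-1/2}) U, where (as usual for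
   the pseudo-inverse, and by MathComp's convention 0^-1 = 0) zero
   eigenvalues of Q_lambda are sent to 0. *)
Definition Qlam_isqrt (R : realType) (d : nat) (U : 'M[R]_d) (nu : 'rV[R]_d)
  (lam : R) : 'M[R]_d :=
  U^T *m diag_mx (\row_i (Num.sqrt (nu 0 i + lam))^-1) *m U.

Definition ridge_dim (R : realType) (d : nat) (nu : 'rV[R]_d) (lam : R) : R :=
  \sum_(i < d) (if 0 < nu 0 i then nu 0 i / (nu 0 i + lam) else 0).

(* (Z_1,...,Z_n) are i.i.d. with law P on the probability space (O, Pr):
   each Z_i is measurable with distribution P, and they are mutually
   independent (product rule for every family of measurable sets; taking
   A_i = setT recovers the product rule for every subfamily). *)
Definition iid_sample (R : realType) (dX : measure_display)
  (X : measurableType dX) (P : probability X R)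
  (dO : measure_display) (O : measurableType dO) (Pr : probability O R)
  (n : nat) (Z : 'I_n -> O -> X) : Prop :=
  (forall i, measurable_fun setT (Z i)) /\
  (forall i A, measurable A -> Pr (Z i @^-1` A) = P A) /\
  (forall A : 'I_n -> set X, (forall i, measurable (A i)) ->
     fine (Pr (\bigcap_(i in [set: 'I_n]) (Z i @^-1` A i)))
     = \prod_(i < n) fine (Pr (Z i @^-1` A i))).

Definition cond_exp_X (R : realType) (dX : measure_display)
  (X : measurableType dX) (P : probability (X * R)%type R)
  (h : (X * R)%type -> R) (g : X -> \bar R) : Prop :=
  measurable_fun setT g /\
  forall A : set X, measurable A ->
    (\int[P]_(z in A `*` [set: R]) g z.1 = \int[P]_(z in A `*` [set: R]) (h z)%:E)%E.

(* Main.v *)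
Require Import Defs.
From HB Require Import structures.
From mathcomp Require Import all_boot all_order all_algebra.
From mathcomp Require Import all_classical all_reals all_analysis.
From mathcomp Require Import measurable_realfun ess_sup_inf ring lra.
Import Order.TTheory GRing.Theory Num.Def Num.Theory.
Import numFieldNormedType.Exports.
Local Open Scope classical_set_scope.
Local Open Scope ring_scope.
Set Implicit Arguments. Unset Strict Implicit. Unset Printing Implicit Defensive.

(** With xi = f_theta~(X) - Y, psi = Q_lambda^{-1/2} phi(X) and zeta = xi psi, convexity
    at the empirical minimiser (used twice: first order optimality and curvature) gives
    excess risk <= 2 |mean of zeta_i - E zeta|^2 as soon as the empirical covariance of
    psi is within 1/4 of its expectation, which a weak law of large numbers ensures.
    Let V be the normalised deviation of the zeta_i and q(t) = E <t, zeta>^2. Only second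
    moments are available, so exp <t, V> is replaced by a product of factors
    1 + y_i + y_i^2 with y_i = <t, zeta_i> / sqrt n: it dominates exp <t, V> unless some
    |zeta_i| is of order sqrt n, an event of vanishing probability, and after
    normalisation by exp (- q(t)) it has mean at most 1. Averaging over t drawn from a
    bounded, nearly Gaussian mixture (sums of many small random signs along the axes) and
    applying Jensen's inequality under the exponentially tilted signs turns this into
    |V|^2 <= 8 E|zeta|^2 + 80 (sup_t q(t)/|t|^2) log (4/eps'), a dimension-free bound
    that separates the trace from the operator norm of the covariance. *)

(** * Elementary inequalities *)

(** The mixing law has to be chosen before n and have bounded support: the factor bound asks for <t,
    zeta_i> <= sqrt n / 3 for all t of the support at once, which a truly Gaussian t would violate.
    A finite list of sign sums achieves this and turns the average over t into a finite sum. The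
    price is that the list is tuned to one squared radius r2; a longer deviation is first shrunk to
    that radius, and the shrinking is paid for by adjoining the opposite vectors. Let S bound
    q(t)/|t|^2 and let A bound the trace. With variance beta per axis, the logarithm of the average
    is at least beta r2/4 - (5/4) S beta^2 r2 - beta A. The choice beta = 1/(10 S) maximises the
    part in r2 and leaves (r2/80 - A/10)/S; equating this with log (4/eps') yields the constants 8
    and 80. Degenerate cases shape several statements: directions with nu_k + lambda = 0, where the
    inverse square root is 0 by convention, a vanishing S, and an infinite supremum. *)

Section elementary.
Context {R : realType}.
Implicit Types x y z p : R.

(** Squaring [1 - y/2 <= exp (- y/2)] reduces the claim to [1 <= (1 + y + y^2) (1 - y/2)^2]. The
    product equals [1 + y^2/4 ((1 - 3 y) + y^2)], whence the threshold 1/3. *)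
Lemma expR_le_quadratic y : y <= 3^-1 -> expR y <= 1 + y + y ^+ 2.
Proof.
move=> y1; have y0 : 0 < 1 - y / 2 by lra.
have h : (1 - y / 2) ^+ 2 <= (expR y)^-1.
  rewrite -expRN [- y](_ : _ = 2%:R * (- y / 2)); last by field.
  rewrite expRM_natl ler_pXn2r ?nnegrE ?(ltW y0) ?expR_ge0//.
  by have := expR_ge1Dx (- y / 2); rewrite mulNr.
have : 1 <= (1 + y + y ^+ 2) * (1 - y / 2) ^+ 2.
  have -> : (1 + y + y ^+ 2) * (1 - y / 2) ^+ 2 =
    1 + y ^+ 2 / 4 * ((1 - 3 * y) + y ^+ 2) by field.
  rewrite lerDl mulr_ge0 ?divr_ge0 ?sqr_ge0// addr_ge0 ?sqr_ge0//; lra.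
move=> /le_trans /(_ (ler_wpM2l _ h)) H.
have /H : 0 <= 1 + y + y ^+ 2 by nra.
by rewrite ler_pdivlMr ?expR_gt0// mul1r.
Qed.

(** The hyperbolic cosine, normaliser of an exponentially tilted sign. *)
Definition ch y : R := (expR y + expR (- y)) / 2.

Lemma ch_gt0 y : 0 < ch y.
Proof. by rewrite divr_gt0 // addr_gt0 ?expR_gt0. Qed.

(** Adding [(1 + z/4)^4 <= exp z] at [y] and [- y] cancels the odd powers and leaves at least
    [1 + 3/8 y^2]. With [z = 3/8 y^2], which is at most 1/2, [exp (2z/3) <= 1/(1 - 2z/3) <= 1 + z]
    concludes. *)
Lemma ch_ge y : `|y| <= 1 -> expR (y ^+ 2 / 4) <= ch y.
Proof.
move=> y1.
have y2 : y ^+ 2 <= 1 by rewrite -real_normK ?num_real// expr_le1.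
have e4 z : -1 <= z -> 0 <= 1 + z / 4 by move=> ?; lra.
have p4 z : -1 <= z -> (1 + z / 4) ^+ 4 <= expR z.
  move=> z1; rewrite [z in expR z](_ : z = 4%:R * (z / 4)); last by field.
  by rewrite expRM_natl ler_pXn2r ?nnegrE ?e4 ?expR_ge0 ?expR_ge1Dx.
have [ym yp] : -1 <= y /\ y <= 1 by move: y1; rewrite ler_norml => /andP.
have h1 := p4 y ym.
have h2 : (1 + (- y) / 4) ^+ 4 <= expR (- y) by apply: p4; lra.
have h3 : 1 + 3 / 8 * y ^+ 2 <= ch y.
  rewrite /ch ler_pdivlMr//; apply: le_trans (lerD h1 h2).
  have : 0 <= y ^+ 4 by rewrite exprn_even_ge0.
  nra.
apply: le_trans h3.
set z := 3 / 8 * _; have z0 : 0 <= z by rewrite mulr_ge0// sqr_ge0.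
have zy : y ^+ 2 / 4 = 2 / 3 * z by rewrite /z; field.
have := expR_ge1Dx (- (2 / 3 * z)); rewrite expRN zy => h.
have zle : z <= 3 / 8 by rewrite /z; lra.
have h5 : 0 < 1 - 2 / 3 * z by lra.
apply: (@le_trans _ _ (1 - 2 / 3 * z)^-1).
  by rewrite -[leLHS]invrK lef_pV2 ?posrE ?invr_gt0 ?expR_gt0.
rewrite -div1r ler_pdivrMr//; nra.
Qed.

(** The hyperbolic tangent, mean of a sign with weights proportional to [expR y] and
    [expR (- y)]. *)
Definition th y : R := (expR y - expR (- y)) / (expR y + expR (- y)).

Lemma thN y : th (- y) = - th y.
Proof. by rewrite /th opprK -mulNr opprB [in X in _ / X]addrC. Qed.

(** For [y >= 0], [G = exp (- 2 y) >= 1 - 2 y] gives [th y = (1 - G)/(1 + G) <= y/(1 - y)], and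
    [1/(1 - y) <= 10/9] on this range. *)
Lemma normr_th_le y : `|y| <= 10^-1 -> `|th y| <= 10 / 9 * `|y|.
Proof.
wlog y0 : y / 0 <= y => [h hy|].
  have [/h|y0] := leP 0 y; first exact.
  by rewrite -normrN -thN -[`|y|]normrN h ?normrN// oppr_ge0 ltW.
rewrite [`|y|]ger0_norm// => y1.
have E0 := expR_gt0 y; have F0 := expR_gt0 (- y).
have EF : expR y * expR (- y) = 1 by rewrite expRN divff// gt_eqF.
have Fle : expR (- y) <= expR y by rewrite ler_expR; lra.
have F1 : expR (- y) <= 1 by rewrite expR_le1; lra.
have th0 : 0 <= th y by rewrite /th divr_ge0 ?subr_ge0 ?(ltW (addr_gt0 E0 F0)).
rewrite ger0_norm// /th ler_pdivrMr ?addr_gt0//.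
have h := expR_ge1Dx (- (2 * y)).
have e2 : expR (- (2 * y)) = expR (- y) ^+ 2.
  by rewrite -mulrN expRM_natl.
have eF : expR (- y) = expR y * expR (- (2 * y)).
  by rewrite e2 expr2 mulrA EF mul1r.
rewrite eF; set G := expR (- (2 * y)) in h e2 eF *.
have G1 : G <= 1 by rewrite expR_le1; lra.
have -> : expR y - expR y * G = expR y * (1 - G) by ring.
have -> : 10 / 9 * y * (expR y + expR y * G) = expR y * (10 / 9 * y * (1 + G)) by ring.
apply: ler_wpM2l; [exact: ltW|nra].
Qed.

(** Pays for shrinking a deviation: the sign of [z] is unknown, so both exponentials appear on the
    right. *)
Lemma expR_contract_le (rho z : R) : 0 <= rho <= 1 ->
  expR (rho * z) <= expR z + expR (- z).
Proof.
move=> /andP[r0 r1]; have [z0|z0] := leP 0 z.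
  by rewrite (@le_trans _ _ (expR z)) ?lerDl ?expR_ge0// ler_expR; nra.
rewrite (@le_trans _ _ (expR (- z))) ?lerDr ?expR_ge0// ler_expR; nra.
Qed.

Lemma expR_jensen2 (p a b : R) : 0 <= p <= 1 ->
  expR (p * a + (1 - p) * b) <= p * expR a + (1 - p) * expR b.
Proof.
move=> /andP[p0 p1]; set m := _ + _.
have tangent c : expR m * (1 + (c - m)) <= expR c.
  have -> : expR c = expR m * expR (c - m) by rewrite -expRD subrKC.
  by rewrite ler_wpM2l ?expR_ge0 ?expR_ge1Dx.
have ha := ler_wpM2l p0 (tangent a).
have q0 : 0 <= 1 - p by lra.
have hb := ler_wpM2l q0 (tangent b).
have := lerD ha hb; apply: le_trans.
by rewrite le_eqVlt; apply/orP; left; apply/eqP; rewrite /m; ring.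
Qed.

End elementary.

(** * Euclidean inner product and Cauchy-Schwarz *)

Section dot_product.
Context {R : realType} {d : nat}.
Implicit Types u v w t : 'rV[R]_d.

Lemma dotvC u v : dotv u v = dotv v u.
Proof. by apply: eq_bigr => i _; rewrite mulrC. Qed.

Lemma dotvDl u v w : dotv (u + v) w = dotv u w + dotv v w.
Proof. by rewrite -big_split/=; apply: eq_bigr => i _; rewrite mxE mulrDl. Qed.

Lemma dotvZl (c : R) u w : dotv (c *: u) w = c * dotv u w.
Proof. by rewrite mulr_sumr; apply: eq_bigr => i _; rewrite mxE mulrA. Qed.

Lemma dotvNl u w : dotv (- u) w = - dotv u w.
Proof. by rewrite -scaleN1r dotvZl mulN1r. Qed.

Lemma dotvDr u v w : dotv w (u + v) = dotv w u + dotv w v.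
Proof. by rewrite dotvC dotvDl !(dotvC w). Qed.

Lemma dotvZr (c : R) u w : dotv w (c *: u) = c * dotv w u.
Proof. by rewrite dotvC dotvZl (dotvC w). Qed.

Lemma dot0v w : dotv 0 w = 0.
Proof. by rewrite /dotv big1// => i _; rewrite mxE mul0r. Qed.

Lemma dotv_suml I (r : seq I) (F : I -> 'rV[R]_d) w :
  dotv (\sum_(i <- r) F i) w = \sum_(i <- r) dotv (F i) w.
Proof.
by elim: r => [|a r ih]; rewrite ?big_nil ?dot0v// !big_cons dotvDl ih.
Qed.

Lemma dotv_deltal k w : dotv (delta_mx 0 k) w = w 0 k.
Proof.
rewrite /dotv (bigD1 k)//= mxE !eqxx mul1r big1 ?addr0// => i /negPf ik.
by rewrite mxE eqxx ik mul0r.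
Qed.

Lemma sqnormE u : sqnorm u = \sum_i u 0 i ^+ 2.
Proof. by apply: eq_bigr => i _; rewrite expr2. Qed.

Lemma sqnorm_ge0 u : 0 <= sqnorm u.
Proof. by rewrite sqnormE sumr_ge0// => i _; exact: sqr_ge0. Qed.

Lemma cauchy_schwarz (I : finType) (f g : I -> R) :
  (\sum_i f i * g i) ^+ 2 <= (\sum_i f i ^+ 2) * (\sum_i g i ^+ 2).
Proof.
set a := \sum_i f i ^+ 2; set b := \sum_i g i ^+ 2; set c := \sum_i _.
have quad x y : 0 <= x ^+ 2 * a + 2 * x * y * c + y ^+ 2 * b.
  rewrite /a /b /c !mulr_sumr -!big_split/=; apply: sumr_ge0 => i _.
  rewrite [X in 0 <= X](_ : _ = (x * f i + y * g i) ^+ 2) ?sqr_ge0//; ring.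
have a0 : 0 <= a by apply: sumr_ge0 => i _; exact: sqr_ge0.
have [a00|a00] := eqVneq a 0.
  have b0 : 0 <= b by apply: sumr_ge0 => i _; exact: sqr_ge0.
  rewrite a00 mul0r; suff -> : c = 0 by rewrite expr0n.
  have fi0 i : f i = 0.
    apply/eqP; rewrite -sqrf_eq0; apply/eqP/(psumr_eq0P _ a00) => // j _.
    exact: sqr_ge0.
  by rewrite /c big1// => i _; rewrite fi0 mul0r.
have ap : 0 < a by rewrite lt_neqAle eq_sym a00.
have := quad c (- a).
have -> : c ^+ 2 * a + 2 * c * - a * c + (- a) ^+ 2 * b = a * (a * b - c ^+ 2) by ring.
by rewrite pmulr_rge0// subr_ge0.
Qed.

Lemma sqr_dotv_le u v : dotv u v ^+ 2 <= sqnorm u * sqnorm v.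
Proof. by rewrite !sqnormE; exact: cauchy_schwarz. Qed.

End dot_product.

(** * Mixtures of random signs *)

Section sign_mixture.
Context {R : realType} {d : nat}.
Implicit Types (u v w t x a : 'rV[R]_d) (l : seq 'rV[R]_d).

(** A list with repetitions, so that its uniform average is the expectation over independent fair
    signs. *)
Fixpoint sgn_sums l : seq 'rV[R]_d :=
  if l is a :: l' then
    [seq a + t | t <- sgn_sums l'] ++ [seq - a + t | t <- sgn_sums l']
  else [:: 0].

Lemma size_sgn_sums l : size (sgn_sums l) = (2 ^ size l)%N.
Proof.
by elim: l => //= a l ih; rewrite size_cat !size_map ih expnS mul2n addnn.
Qed.

(** Mean of the signed sum of [l] under the law reweighted by [expR (dotv t x)]. *)
Definition tilt l x := \sum_(a <- l) th (dotv a x) *: a.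

Variables (q : 'rV[R]_d -> R) (b : 'rV[R]_d -> 'rV[R]_d -> R).
Hypothesis qE : forall u a (s : R), q (u + s *: a) = q u + 2 * s * b u a + s ^+ 2 * q a.
Hypothesis qZ : forall (s : R) a, q (s *: a) = s ^+ 2 * q a.
Hypothesis q_ge0 : forall u, 0 <= q u.

(* One random sign, tilted by its exponential weight, has mean [th y] and
   variance at most 1; Jensen then moves the expectation into the exponent. *)
Lemma tilted_sign_jensen u a (y : R) :
  ch y * expR (- q (u + th y *: a) - q a) <=
  (expR y * expR (- q (u + a)) + expR (- y) * expR (- q (u - a))) / 2.
Proof.
have E0 := expR_gt0 y; have F0 := expR_gt0 (- y).
set E := expR y in E0 *; set F := expR (- y) in F0 *.
have EF0 : E + F != 0 by rewrite gt_eqF// addr_gt0.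
pose p : R := E / (E + F).
have p01 : 0 <= p <= 1.
  rewrite divr_ge0 ?(ltW E0) ?(ltW (addr_gt0 _ _))//=.
  by rewrite ler_pdivrMr ?addr_gt0// mul1r lerDl ltW.
have p1 : 1 - p = F / (E + F) by rewrite /p; field.
have thp : th y = 2 * p - 1 by rewrite /th -/E -/F /p; field.
have := expR_jensen2 (- q (u + a)) (- q (u - a)) p01.
have ua : q (u + a) = q u + 2 * b u a + q a.
  by rewrite -[a in LHS]scale1r qE mulr1 expr1n mul1r.
have uma : q (u - a) = q u - 2 * b u a + q a.
  by rewrite -scaleN1r qE sqrrN expr1n mul1r mulrN1 mulNr.
set lhs := expR _ => h1.
have h2 : expR (- q (u + th y *: a) - q a) <= lhs.
  rewrite ler_expR qE ua uma thp.
  rewrite -subr_ge0 [X in 0 <= X](_ : _ = (2 * p - 1) ^+ 2 * q a); last by ring.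
  by rewrite mulr_ge0 ?sqr_ge0.
have h3 : ch y = (E + F) / 2 by [].
apply: (@le_trans _ _ (ch y * (p * expR (- q (u + a)) + (1 - p) * expR (- q (u - a))))).
  by rewrite ler_wpM2l ?(ltW (ch_gt0 _))// (le_trans h2).
by rewrite le_eqVlt h3 p1 /p; apply/orP; left; apply/eqP; field.
Qed.

(** Under the reweighted law the signs remain independent: the normaliser is the product of the
    [ch], the mean is [t0 + tilt l x], and each sign raises the mean of [q] by at most [q a]. The
    induction peels off one sign and lets the shift [t0] absorb it. *)
Lemma sgn_mixture_lower_bound l x t0 :
  expR (dotv t0 x) * \prod_(a <- l) ch (dotv a x) *
    expR (- q (t0 + tilt l x) - \sum_(a <- l) q a) <=
  2^-1 ^+ size l * \sum_(t <- sgn_sums l) expR (dotv (t0 + t) x - q (t0 + t)).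
Proof.
elim: l t0 => [|a l ih] t0.
  by rewrite /tilt !big_nil big_cons big_nil !addr0 subr0 mulr1 mul1r expRD.
rewrite /= big_cat/= !big_map !big_cons /tilt big_cons -/(tilt l x).
set y := dotv a x; set Pi := \prod_(a <- l) _; set Sg := \sum_(a <- l) q a.
set u := t0 + tilt l x.
have h1 := ih (t0 + a); have h2 := ih (t0 - a).
rewrite -/Pi -/Sg in h1 h2.
under [X in _ <= _ * (X + _)]eq_bigr do rewrite addrA.
under [X in _ <= _ * (_ + X)]eq_bigr do rewrite addrA.
rewrite exprS -[leRHS]mulrA [in leRHS]mulrDr.
have Pi0 : 0 <= Pi by apply: prodr_ge0 => i _; rewrite ltW// ch_gt0.
have key := tilted_sign_jensen u a y.
apply: le_trans (ler_wpM2l _ (lerD h1 h2)); last by rewrite invr_ge0.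
rewrite dotvDl dotvDl dotvNl -/y.
have -> : t0 + a + tilt l x = u + a by rewrite /u addrAC.
have -> : t0 - a + tilt l x = u - a by rewrite /u addrAC.
have -> : t0 + (th y *: a + tilt l x) = u + th y *: a by rewrite /u addrAC addrA.
set k := expR (dotv t0 x) * Pi * expR (- Sg).
have k0 : 0 <= k by rewrite /k !mulr_ge0 ?expR_ge0.
have := ler_wpM2l k0 key; rewrite !expRD /k.
have -> : expR (- (q a + Sg)) = expR (- q a) * expR (- Sg) by rewrite opprD expRD.
rewrite (mulrC 2^-1) => h.
apply: (le_trans _ (le_trans h _)); rewrite le_eqVlt; apply/orP; left; apply/eqP; ring.
Qed.

(** The list precedes [x], so it can be fixed before any sample is drawn and used on the whole
    sphere of squared radius [r2]. *)
Lemma sgn_mixture_exists (S A r2 : R) : 0 < S -> 0 <= r2 ->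
  (forall t, q t <= S * sqnorm t) -> \sum_k q (delta_mx 0 k) <= A ->
  exists ts : seq 'rV[R]_d, (0 < size ts)%N /\
    forall x, sqnorm x = r2 ->
    expR ((r2 / 80 - A / 10) / S) <=
      (size ts)%:R^-1 * \sum_(t <- ts) expR (dotv t x - q t).
Proof.
move=> S0 r20 qS qA.
pose beta : R := (10 * S)^-1.
have beta0 : 0 < beta by rewrite invr_gt0 mulr_gt0.
(* Each axis receives [m.+1] signs of common size [c], with total variance [beta], and enough of
   them that [c |x_k| <= 1/10] on the sphere; the estimates of [ch] and [th] then apply. *)
have [m mP] : exists m : nat, 100 * beta * r2 <= m.+1%:R.
  have h0 : 0 <= 100 * beta * r2 by rewrite !mulr_ge0// ltW.
  exists (Num.bound (100 * beta * r2)).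
  by rewrite (le_trans (ltW (archi_boundP h0)))// ler_nat.
have m0 : 0 < m.+1%:R :> R by rewrite ltr0n.
set M : R := m.+1%:R in m0 mP.
pose c : R := Num.sqrt (beta / M).
have c2 : c ^+ 2 = beta / M by rewrite sqr_sqrtr// divr_ge0 ?ltW.
have c0 : 0 <= c by rewrite sqrtr_ge0.
have Mc2 : M * c ^+ 2 = beta by rewrite c2 mulrC divfK// gt_eqF.
pose l := [seq c *: delta_mx 0 k : 'rV[R]_d | k <- enum 'I_d, j <- iota 0 m.+1].
have big_l (T : zmodType) (F : 'rV[R]_d -> T) :
    \sum_(a <- l) F a = \sum_k F (c *: delta_mx 0 k) *+ m.+1.
  rewrite big_allpairs_dep big_enum; apply: eq_bigr => k _.
  by rewrite big_const_seq count_predT size_iota -Monoid.iteropE/=.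
exists (sgn_sums l); split; first by rewrite size_sgn_sums expn_gt0.
move=> x xr.
have := sgn_mixture_lower_bound l x 0.
rewrite dot0v expR0 mul1r add0r.
under [X in _ <= _ * X]eq_bigr do rewrite add0r.
rewrite size_sgn_sums natrX -exprVn; apply: le_trans.
have yk k : (c * x 0 k) ^+ 2 <= 100^-1.
  rewrite exprMn c2.
  have xk : x 0 k ^+ 2 <= r2.
    rewrite -xr sqnormE (bigD1 k)//= lerDl sumr_ge0// => i _; exact: sqr_ge0.
  apply: (@le_trans _ _ (beta / M * r2)).
    by rewrite ler_wpM2l// divr_ge0 ?ltW.
  rewrite mulrAC ler_pdivrMr//; lra.
have yk1 k : `|c * x 0 k| <= 10^-1.
  rewrite -[`|_|]ger0_norm// -ler_sqr ?nnegrE// ?invr_ge0// real_normK ?num_real//.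
  rewrite real_normK ?num_real//; apply: le_trans (yk k) _; lra.
have hprod : expR (beta * r2 / 4) <= \prod_(a <- l) ch (dotv a x).
  have -> : \prod_(a <- l) ch (dotv a x) = \prod_k ch (c * x 0 k) ^+ m.+1.
    rewrite big_allpairs_dep big_enum; apply: eq_bigr => k _.
    rewrite big_const_seq count_predT size_iota dotvZl dotv_deltal.
    by rewrite -Monoid.iteropE/=.
  have -> : beta * r2 / 4 = \sum_k m.+1%:R * ((c * x 0 k) ^+ 2 / 4).
    rewrite -mulr_sumr -mulr_suml -/M.
    under eq_bigr do rewrite exprMn.
    rewrite -mulr_sumr -sqnormE xr -Mc2; ring.
  rewrite expR_sum; apply: ler_prod => k _; rewrite expR_ge0/= expRM_natl.
  rewrite ler_pXn2r ?nnegrE ?expR_ge0 ?(ltW (ch_gt0 _))//.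
  by apply: ch_ge; apply: le_trans (yk1 k) _; lra.
(* The tilted mean has coordinates [M c th (c x_k)], of modulus at most [10/9 beta |x_k|]; the
   constant comes from [(10/9)^2 <= 5/4]. *)
have htilt : sqnorm (tilt l x) <= 5 / 4 * beta ^+ 2 * r2.
  have tk k : tilt l x 0 k = M * (th (c * x 0 k) * c).
    rewrite /tilt big_l summxE (bigD1 k)//= big1 => [|i /negPf ik].
      by rewrite addr0 mulmxnE !mxE !eqxx mulr1 dotvZl dotv_deltal mulr_natl.
    by rewrite mulmxnE !mxE eq_sym ik andbF !mulr0 mul0rn.
  rewrite sqnormE -xr sqnormE mulr_sumr; apply: ler_sum => k _; rewrite tk.
  have := normr_th_le (yk1 k); rewrite (normrM c) (ger0_norm c0) => hth.
  have hth2 : th (c * x 0 k) ^+ 2 <= (10 / 9 * (c * `|x 0 k|)) ^+ 2.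
    by rewrite -[leLHS]real_normK ?num_real// ler_sqr ?nnegrE// !mulr_ge0.
  have eth : (10 / 9 * (c * `|x 0 k|)) ^+ 2 = 100 / 81 * (c ^+ 2 * x 0 k ^+ 2).
    by rewrite -[x 0 k ^+ 2]real_normK ?num_real//; field.
  rewrite eth in hth2.
  have := ler_wpM2l (sqr_ge0 (M * c)) hth2.
  have -> : (M * (th (c * x 0 k) * c)) ^+ 2 = (M * c) ^+ 2 * th (c * x 0 k) ^+ 2 by ring.
  move=> /le_trans; apply; rewrite -Mc2.
  have : 0 <= (M * c ^+ 2) ^+ 2 * x 0 k ^+ 2 by rewrite mulr_ge0// sqr_ge0.
  lra.
(* By homogeneity the [M] signs along one axis contribute [M c^2 = beta] times the diagonal entry of
   [q]. *)
have hqa : \sum_(a <- l) q a <= beta * A.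
  rewrite big_l.
  apply: (@le_trans _ _ (beta * \sum_k q (delta_mx 0 k))); last first.
    by rewrite ler_wpM2l// ltW.
  rewrite mulr_sumr; apply: ler_sum => k _.
  by rewrite -mulr_natl -/M qZ mulrA Mc2.
apply: (@le_trans _ _ (expR (beta * r2 / 4) *
    expR (- (S * (5 / 4 * beta ^+ 2 * r2)) - beta * A))).
  rewrite -expRD ler_expR le_eqVlt; apply/orP; left; apply/eqP.
  by rewrite /beta; field; rewrite gt_eqF.
apply: ler_pM; rewrite ?expR_ge0// ler_expR.
apply: lerB => //; rewrite lerN2.
by apply: le_trans (qS _) _; rewrite ler_wpM2l// ltW.
Qed.
End sign_mixture.

(** * Transfer of integrals and independence *)

Section transfer.
Local Open Scope ereal_scope.
Context {R : realType}.
Import HBNNSimple.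

(** Approximating [h] by simple functions shows that the integral depends on [f] only through the
    set function sending [A] to the integral of [f] over the preimage of [A]. *)
Lemma ge0_integralM_comp (d d' : measure_display) (T : measurableType d)
    (T' : measurableType d') (mu : {measure set T -> \bar R}) (Z : T -> T')
    (f : T -> \bar R) (h : T' -> \bar R) (mh : measurable_fun setT h) :
  measurable_fun setT Z -> measurable_fun setT f -> (forall x, 0 <= f x) ->
  (forall y, 0 <= h y) ->
  let h_ := nnsfun_approx measurableT mh in
  \int[mu]_x (f x * h (Z x)) =
  limn (fun n => \sum_(k \in range (h_ n))
    k%:E * \int[mu]_(x in Z @^-1` (h_ n @^-1` [set k])) f x).
Proof.
move=> mZ mf f0 h0 h_.
have mhZ n : measurable_fun setT (fun x => (h_ n (Z x))%:E).
  by apply/measurable_EFinP; exact: (measurableT_comp (measurable_funP (h_ n)) mZ).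
transitivity (limn (fun n => \int[mu]_x (f x * (h_ n (Z x))%:E))).
  rewrite -monotone_convergence//; last 3 first.
  - by move=> n; exact: emeasurable_funM.
  - by move=> n x _; rewrite mule_ge0// lee_fin.
  - move=> x _ m n mn; rewrite lee_wpmul2l// lee_fin; exact/lefP/nd_nnsfun_approx.
  apply: eq_integral => x _; apply/esym/cvg_lim => //.
  have hc := @cvg_nnsfun_approx _ _ _ _ measurableT _ mh (fun y _ => h0 y) (Z x) I.
  have := f0 x; rewrite le_eqVlt => /orP[/eqP <-|fx0].
    rewrite mul0e; under eq_fun do rewrite mul0e; exact: cvg_cst.
  (* Multiplication by [+oo] is not continuous at 0. The approximants are all 0 if the limit is, and
     eventually positive otherwise, so the products are eventually constant. *)
  have [fy|fy] := eqVneq (f x) +oo; last first.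
    by apply: cvgeZl => //; rewrite ge0_fin_numE// ltey.
  rewrite fy; have := h0 (Z x); rewrite le_eqVlt => /orP[/eqP hz|hz].
    rewrite -hz mule0.
    rewrite (_ : (fun n => _) = cst 0); first exact: cvg_cst.
    apply/funext => n /=; suff -> : h_ n (Z x) = 0%R by rewrite mule0.
    apply/eqP; rewrite eq_le fun_ge0 andbT -lee_fin [leRHS]hz.
    by rewrite nnsfun_approxE; apply: le_approx.
  rewrite gt0_mulye//; apply: cvg_near_cst.
  have : \forall n \near \oo, 0 < (h_ n (Z x))%:E.
    apply: (hc [set y | 0 < y]); apply: open_nbhs_nbhs; split => //.
    exact: open_ereal_gt_ereal.
  by apply: filterS => n hn; rewrite gt0_mulye.
congr (limn _); apply/funext => n.
transitivity (\int[mu]_x (\sum_(k \in range (h_ n))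
    f x * (k * \1_(h_ n @^-1` [set k]) (Z x))%:E)).
  apply: eq_integral => x _; rewrite fimfunE -fsumEFin// ge0_mule_fsumr// => k.
  exact: nnfun_muleindic_ge0.
rewrite ge0_integral_fsum//; last 2 first.
- move=> k; apply: emeasurable_funM => //; apply/measurable_EFinP.
  apply: measurable_funM => //.
  have m1 : measurable_fun setT (\1_(h_ n @^-1` [set k]) : T' -> R).
    exact: measurable_indic.
  exact: (measurableT_comp m1 mZ).
- by move=> k x _; rewrite mule_ge0// nnfun_muleindic_ge0.
apply: eq_fsbigr => k /set_mem[y _ <-].
set A := h_ n @^-1` _; have mA : measurable (Z @^-1` A).
  rewrite -[X in measurable X]setTI; apply: mZ => //.
  exact: measurable_funPTI.
rewrite [in RHS]integral_mkcond -ge0_integralZl//; last 3 first.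
- exact/(measurable_restrictT _ mA)/measurable_funTS.
- by move=> x _; apply: erestrict_ge0.
- by rewrite lee_fin.
apply: eq_integral => x _; rewrite /= patchE indicE.
have -> : (x \in Z @^-1` A) = (Z x \in A) by apply/idP/idP; rewrite !in_setE.
by case: ifP; rewrite ?mulr1 ?mulr0 ?mule0// muleC.
Qed.

(** Two uses: detaching one factor from a product of independent variables, and replacing the
    squared residual by its conditional expectation. *)
Lemma ge0_integralM_transfer (d1 d2 d' : measure_display) (T1 : measurableType d1)
    (T2 : measurableType d2) (T' : measurableType d')
    (mu1 : {measure set T1 -> \bar R}) (mu2 : {measure set T2 -> \bar R})
    (Z1 : T1 -> T') (Z2 : T2 -> T') (f1 : T1 -> \bar R) (f2 : T2 -> \bar R)
    (h : T' -> \bar R) :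
  measurable_fun setT Z1 -> measurable_fun setT Z2 ->
  measurable_fun setT f1 -> measurable_fun setT f2 ->
  (forall x, 0 <= f1 x) -> (forall x, 0 <= f2 x) ->
  (forall A, measurable A ->
    \int[mu1]_(x in Z1 @^-1` A) f1 x = \int[mu2]_(x in Z2 @^-1` A) f2 x) ->
  measurable_fun setT h -> (forall y, 0 <= h y) ->
  \int[mu1]_x (f1 x * h (Z1 x)) = \int[mu2]_x (f2 x * h (Z2 x)).
Proof.
move=> mZ1 mZ2 mf1 mf2 f10 f20 fE mh h0.
rewrite !(ge0_integralM_comp _ mh)//; congr (limn _); apply/funext => n.
by apply: eq_fsbigr => k _; rewrite fE//; exact: measurable_funPTI.
Qed.

End transfer.

Section measurable_level_sets.
Context {R : realType} {d : measure_display} {T : measurableType d}.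

Lemma measurable_sublevel (f : T -> R) (c : R) :
  measurable_fun setT f -> measurable [set x | f x <= c].
Proof.
move=> mf; rewrite -[X in measurable X]setTI.
rewrite (_ : [set x | _] = f @^-1` [set` `]-oo, c]]); first exact: mf.
by apply/seteqP; split => x /=; rewrite in_itv.
Qed.

Lemma measurable_superlevel (f : T -> R) (c : R) :
  measurable_fun setT f -> measurable [set x | c < f x].
Proof.
move=> mf; rewrite -[X in measurable X]setTI.
rewrite (_ : [set x | _] = f @^-1` [set` `]c, +oo[]); first exact: mf.
by apply/seteqP; split => x /=; rewrite in_itv/= andbT.
Qed.

Lemma measurable_bigprod (I : finType) (Q : pred I) (h : I -> T -> R) :
  (forall i, measurable_fun setT (h i)) ->
  measurable_fun setT (fun x => \prod_(i | Q i) h i x).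
Proof.
move=> mh; under eq_fun do rewrite -big_filter.
by apply: measurable_prod => i _; exact: mh.
Qed.

End measurable_level_sets.

(** * Tails of an integrable variable *)

Section tail.
Context {R : realType} {d : measure_display} {T : measurableType d}.
Variable P : probability T R.

Lemma markov_ge0 (f : T -> R) (a : R) : measurable_fun setT f ->
  (forall x, 0 <= f x) -> 0 < a ->
  (a%:E * P [set x | a <= f x]%R <= \int[P]_x (f x)%:E)%E.
Proof.
move=> mf f0 a0.
have /measurable_EFinP mfE := mf.
have := le_integral_abse P measurableT mfE a0.
rewrite setTI; congr (_ * P _ <= _)%E.
- by apply/seteqP; split => x /=; rewrite lee_fin ger0_norm.
- by apply: eq_integral => x _; rewrite gee0_abs// lee_fin.
Qed.

(** Markov's inequality for [W] itself would only bound [n P(W > kappa n)]. Applied to [W] cut off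
    to that event, whose mean vanishes by dominated convergence, it makes the product small, as a
    union bound over [n] points demands. *)
Lemma tail_measure_small (W : T -> R) (kappa eps : R) :
  P.-integrable setT (EFin \o W) -> (forall x, 0 <= W x) -> 0 < kappa -> 0 < eps ->
  exists N : nat, forall n, (N <= n)%N ->
    (n%:R%:E * P [set x | kappa * n%:R < W x]%R <= eps%:E)%E.
Proof.
move=> iW W0 k0 e0.
have mW : measurable_fun setT W by apply/measurable_EFinP; exact: measurable_int iW.
pose B n := [set x | kappa * n%:R < W x].
have mB n : measurable (B n) by exact: measurable_superlevel.
pose f_ n x := (W x * \1_(B n) x)%:E.
have mf_ n : measurable_fun setT (fun x => W x * \1_(B n) x).
  by apply: measurable_funM => //; exact: measurable_indic.
have cvg0 : (\int[P]_x f_ n x @[n --> \oo] --> \int[P]_x (cst 0 x))%E.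
  apply: (@dominated_cvg _ _ _ P setT measurableT f_ (cst 0)%E (EFin \o W)) => //.
  - by move=> n; exact/measurable_EFinP.
  - move=> x _; apply: cvg_near_cst.
    exists (Num.bound (W x / kappa)) => // n /= hn.
    rewrite /f_ indicE memNset ?mulr0//= /B/=; apply/negP; rewrite -leNgt.
    rewrite mulrC -ler_pdivrMr//.
    rewrite (le_trans (ltW (archi_boundP _)))// ?ler_nat//.
    by rewrite divr_ge0// ltW.
  - move=> n x _; rewrite /f_ /= lee_fin normrM ger0_norm// ger0_norm//.
    by rewrite indicE; case: (_ \in _); rewrite ?mulr1// mulr0.
rewrite integral0 in cvg0.
have ek : (0 < (eps * kappa)%:E)%E by rewrite lte_fin mulr_gt0.
have [N _ hN] : \forall n \near \oo, (\int[P]_x f_ n x < (eps * kappa)%:E)%E.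
  by apply: (cvg0 [set y | (y < (eps * kappa)%:E)%E]); apply: open_ereal_lt'.
exists N.+1 => n Nn.
have n0 : 0 < n%:R :> R by rewrite ltr0n; case: n Nn.
have := markov_ge0 (mf_ n) (fun x => mulr_ge0 (W0 x) (ler0n _ _)) (mulr_gt0 k0 n0).
move=> /le_lt_trans/(_ (hN _ (ltnW Nn)))/ltW h.
have h2 : ((kappa * n%:R)%:E * P (B n) <= (eps * kappa)%:E)%E.
  apply: le_trans h; rewrite lee_wpmul2l ?lee_fin ?mulr_ge0 ?(ltW k0)//.
  apply: le_measure; rewrite ?inE//.
    rewrite (_ : [set x | _] = ~` [set x | W x * \1_(B n) x < kappa * n%:R]).
      apply: measurableC; rewrite -[X in measurable X]setTI.
      rewrite (_ : [set x | _] = (fun x => W x * \1_(B n) x) @^-1` [set` `]-oo, (kappa * n%:R)[]).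
        exact: mf_.
      by apply/seteqP; split => x /=; rewrite in_itv.
    by apply/seteqP; split => x /=; [rewrite leNgt => /negP|move=> /negP; rewrite -leNgt].
  by move=> x Bx /=; rewrite indicE mem_set// mulr1; exact: ltW.
move: h2; rewrite -/(B n) -(fineK (fin_num_measure P _ (mB n))) -!EFinM !lee_fin.
by move=> h2; rewrite -(ler_pM2l k0) mulrA (mulrC kappa eps).
Qed.

End tail.

(** * Products and unions over an independent sample *)

Section iid.
Context {R : realType} {dX : measure_display} {X : measurableType dX}.
Variable P : probability X R.
Context {dO : measure_display} {O : measurableType dO}.
Variables (Pr : probability O R) (n : nat) (Z : 'I_n -> O -> X).
Hypothesis iidZ : iid_sample P Pr Z.

Let mZ i : measurable_fun setT (Z i). Proof. by case: iidZ. Qed.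

Let mZA i A : measurable A -> measurable (Z i @^-1` A).
Proof. by move=> mA; rewrite -[X in measurable X]setTI; exact: mZ. Qed.

Lemma iid_integral_prod (h : X -> R) (c : R) :
  measurable_fun setT h -> (forall x, 0 <= h x) ->
  (\int[P]_x (h x)%:E = c%:E)%E ->
  (\int[Pr]_w (\prod_i h (Z i w))%:E = (c ^+ n)%:E)%E.
Proof.
move=> mh h0 hc.
have c0 : 0 <= c by rewrite -lee_fin -hc integral_ge0// => x _; rewrite lee_fin.
(* Hybrid product: [h] in the first [J] factors, indicators in the others. [J = 0] is the product
   rule on rectangles, [J = n] is the claim, and each induction step converts one indicator. *)
pose F (J : nat) (A : 'I_n -> set X) (i : 'I_n) w : R :=
  if (i < J)%N then h (Z i w) else \1_(A i) (Z i w).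
pose G (J : nat) (A : 'I_n -> set X) (i : 'I_n) : R :=
  if (i < J)%N then c else fine (P (A i)).
have F0 J A i w : 0 <= F J A i w by rewrite /F; case: ifP.
have G0 J A i : 0 <= G J A i by rewrite /G; case: ifP => // _; rewrite fine_ge0.
have mF J A i : (forall i, measurable (A i)) -> measurable_fun setT (F J A i).
  move=> mA; rewrite /F; case: (i < J)%N; first exact: (measurableT_comp mh (mZ i)).
  have m1 : measurable_fun setT (\1_(A i) : X -> R) by exact: measurable_indic.
  exact: (measurableT_comp m1 (mZ i)).
suff main J : (J <= n)%N -> forall A, (forall i, measurable (A i)) ->
    (\int[Pr]_w (\prod_i F J A i w)%:E = (\prod_i G J A i)%:E)%E.
  have := main n (leqnn n) (fun=> setT) (fun=> measurableT).
  under eq_integral do under eq_bigr do rewrite /F ltn_ord.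
  by under eq_bigr do rewrite /G ltn_ord; rewrite prodr_const card_ord.
elim: J => [_ A mA|J ih Jn A mA].
  have [_ [ZP Zind]] := iidZ.
  transitivity (\int[Pr]_w (\1_(\bigcap_(i in [set: 'I_n]) (Z i @^-1` A i)) w)%:E)%E.
    apply: eq_integral => w _; congr (_%:E); rewrite indicE.
    case: (pselect (forall i, A i (Z i w))) => [Aw|nAw].
      rewrite mem_set; last by move=> i _; exact: Aw.
      by rewrite big1// => i _; rewrite /F indicE mem_set.
    rewrite memNset; last by move=> Aw; apply: nAw => i; exact: Aw.
    have /existsNP[i nAi] := nAw.
    by rewrite (bigD1 i)//= /F indicE memNset// mul0r.
  have mI : measurable (\bigcap_(i in [set: 'I_n]) (Z i @^-1` A i)).
    apply: fin_bigcap_measurable => //.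
    by move=> i _; exact: mZA.
  rewrite integral_indic// setIT -[LHS]fineK; last exact: fin_num_measure.
  by rewrite Zind//; congr (_%:E); apply: eq_bigr => i _; rewrite ZP.
pose j0 := Ordinal Jn.
have ltE i : i != j0 -> (i < J.+1)%N = (i < J)%N.
  by move=> ij; rewrite ltnS leq_eqVlt (_ : (i == J :> nat) = false)//; exact/negbTE.
pose f1 w := (\prod_(i | i != j0) F J A i w)%:E.
pose c' := \prod_(i | i != j0) G J A i.
have f1E B w : \prod_(i | i != j0) F J A i w =
    \prod_(i | i != j0) F J (fun i => if i == j0 then B else A i) i w.
  by apply: eq_bigr => i /negPf ij; rewrite /F ij.
have mf1 : measurable_fun setT f1.
  by apply/measurable_EFinP; apply: measurable_bigprod => i; exact: mF.
transitivity (\int[Pr]_w (f1 w * (h (Z j0 w))%:E))%E.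
  apply: eq_integral => w _; rewrite -EFinM mulrC; congr (_%:E).
  rewrite (bigD1 j0)//= {1}/F ltnSn; congr (_ * _).
  by apply: eq_bigr => i ij; rewrite /F ltE.
(* The induction hypothesis, with [A j0] replaced by an arbitrary [B], says that the measure with
   density [f1] is pushed by [Z j0] to [c'] times [P]. *)
rewrite (ge0_integralM_transfer (T2 := X) (mu2 := P) (Z2 := id) (f2 := cst c'%:E)
  (h := EFin \o h))//=.
- rewrite ge0_integralZl//=; last 3 first.
  + exact/measurable_EFinP.
  + by move=> x _; rewrite lee_fin.
  + by rewrite lee_fin; apply: prodr_ge0.
  rewrite hc -EFinM mulrC; congr (_%:E).
  rewrite [RHS](bigD1 j0)//= {1}/G ltnSn; congr (_ * _).
  by apply: eq_bigr => i ij; rewrite /G ltE.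
- by move=> w; rewrite lee_fin prodr_ge0.
- by move=> _; rewrite lee_fin prodr_ge0.
- move=> B mB; rewrite integral_cst//.
  have := ih (ltnW Jn) (fun i => if i == j0 then B else A i).
  have mA' i : measurable (if i == j0 then B else A i) by case: ifP.
  move=> /(_ mA').
  rewrite (bigD1 j0)//= {1}/G ltnn eqxx.
  have -> : \prod_(i | i != j0) G J (fun i => if i == j0 then B else A i) i = c'.
    by apply: eq_bigr => i /negPf ij; rewrite /G ij.
  rewrite EFinM fineK ?fin_num_measure// muleC => <-.
  rewrite integral_mkcond; apply: eq_integral => w _.
  rewrite patchE (bigD1 j0)//= {1}/F ltnn eqxx indicE.
  rewrite (_ : (w \in Z j0 @^-1` B) = (Z j0 w \in B)); last first.
    by apply/idP/idP; rewrite !in_setE.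
  by rewrite -f1E; case: ifP => _; rewrite ?mul1r// mul0r.
- exact/measurable_EFinP.
Qed.

Lemma iid_union_bound (B : set X) : measurable B ->
  measurable (\big[setU/set0]_i (Z i @^-1` B)) /\
  (Pr (\big[setU/set0]_i (Z i @^-1` B)) <= n%:R%:E * P B)%E.
Proof.
move=> mB; split; first by apply: bigsetU_measurable => i _; exact: mZA.
apply: (@le_trans _ _ (\sum_(i < n) P B)%E); last first.
  rewrite -[P B]fineK ?fin_num_measure// sumEFin sumr_const card_ord.
  by rewrite -EFinM lee_fin mulr_natl.
have [_ [ZP _]] := iidZ.
apply: (@le_trans _ _ (\sum_(i < n) Pr (Z i @^-1` B))%E); last first.
  by apply: lee_sum => i _; rewrite ZP.
have : measurable (\big[setU/set0]_i (Z i @^-1` B)) /\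
  (Pr (\big[setU/set0]_i (Z i @^-1` B)) <= \sum_(i < n) Pr (Z i @^-1` B))%E; last by case.
apply: (big_rec2 (fun A x => measurable A /\ (Pr A <= x)%E)) => [|i x A _ [mA Ax]].
  by rewrite measure0.
split; first by apply: measurableU => //; exact: mZA.
by apply: le_trans (measureU2 _ _ _) _ => //; [exact: mZA|exact: leeD].
Qed.

End iid.

(** * Expectations *)

Section expectation.
Context {R : realType} {d : measure_display} {T : measurableType d}.
Variable P : probability T R.
Implicit Types f g : T -> R.

Definition L1 f := P.-integrable setT (EFin \o f).
(** Measurability is a separate clause, since integrability of the square does not imply it. *)
Definition L2 f := measurable_fun setT f /\ L1 (fun z => f z ^+ 2).

Lemma L1_measurable f : L1 f -> measurable_fun setT f.
Proof. by move=> /measurable_int/measurable_EFinP. Qed.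

Lemma expectE f : L1 f -> (\int[P]_z (f z)%:E = (expect P f)%:E)%E.
Proof. by move=> h; rewrite /expect fineK// integrable_fin_num. Qed.

Lemma eq_expect f g : f =1 g -> expect P f = expect P g.
Proof. by move=> fg; congr (expect P _); apply/funext. Qed.

Lemma eq_L1 f g : f =1 g -> L1 f -> L1 g.
Proof. by move=> /funext ->. Qed.

Lemma L1D f g : L1 f -> L1 g -> L1 (fun z => f z + g z).
Proof. by move=> hf hg; have := integrableD measurableT hf hg. Qed.

Lemma L1Z (c : R) f : L1 f -> L1 (fun z => c * f z).
Proof. by move=> hf; have := integrableZl measurableT c hf. Qed.

Lemma L1_cst (c : R) : L1 (fun=> c).
Proof. exact: finite_measure_integrable_cst. Qed.

Lemma L1_sum (I : Type) (s : seq I) (F : I -> T -> R) :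
  (forall i, L1 (F i)) -> L1 (fun z => \sum_(i <- s) F i z).
Proof.
move=> hF; elim: s => [|a s ih].
  by apply: eq_L1 (L1_cst 0) => z; rewrite big_nil.
by apply: eq_L1 (L1D (hF a) ih) => z; rewrite big_cons.
Qed.

Lemma L1_le f g : measurable_fun setT f -> (forall z, `|f z| <= g z) -> L1 g -> L1 f.
Proof.
move=> mf fg hg; apply: (le_integrable measurableT _ _ hg).
  exact/measurable_EFinP.
by move=> z _; rewrite /= lee_fin (le_trans (fg z))// ler_norm.
Qed.

Lemma expectD f g : L1 f -> L1 g ->
  expect P (fun z => f z + g z) = expect P f + expect P g.
Proof. by move=> hf hg; exact: (RintegralD measurableT hf hg). Qed.

Lemma expectZ (c : R) f : L1 f -> expect P (fun z => c * f z) = c * expect P f.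
Proof. by move=> hf; exact: (@RintegralZl _ _ _ P setT f c measurableT hf). Qed.

Lemma expect_cst (c : R) : expect P (fun=> c) = c.
Proof.
by rewrite /expect integral_cst//= [X in (_ * X)%E]probability_setT mule1.
Qed.

Lemma expect_sum (I : Type) (s : seq I) (F : I -> T -> R) : (forall i, L1 (F i)) ->
  expect P (fun z => \sum_(i <- s) F i z) = \sum_(i <- s) expect P (F i).
Proof.
move=> hF; elim: s => [|a s ih].
  by rewrite big_nil (eq_expect (g := fun=> 0)) ?expect_cst// => z; rewrite big_nil.
rewrite big_cons -ih -(expectD (hF a) (L1_sum s hF)).
by apply: eq_expect => z; rewrite big_cons.
Qed.

Lemma expect_ge0 f : (forall z, 0 <= f z) -> 0 <= expect P f.
Proof. by move=> f0; rewrite fine_ge0// integral_ge0// => z _; rewrite lee_fin. Qed.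

Lemma le_expect f g : L1 f -> L1 g -> (forall z, f z <= g z) ->
  expect P f <= expect P g.
Proof. by move=> hf hg fg; apply: (le_Rintegral measurableT hf hg) => z _. Qed.

Lemma L2M f g : L2 f -> L2 g -> L1 (fun z => f z * g z).
Proof.
move=> [mf f2] [mg g2]; apply: (L1_le _ _ (L1D f2 g2)).
  exact: measurable_funM.
move=> z; rewrite normrM -[f z ^+ 2]real_normK ?num_real//.
rewrite -[g z ^+ 2]real_normK ?num_real//; nra.
Qed.

Lemma L2_cst (c : R) : L2 (fun=> c).
Proof. by split; [exact: measurable_cst|exact: L1_cst]. Qed.

Lemma L2_L1 f : L2 f -> L1 f.
Proof. by move=> h; apply: eq_L1 (L2M h (L2_cst 1)) => z; rewrite mulr1. Qed.

Lemma L2Z (c : R) f : L2 f -> L2 (fun z => c * f z).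
Proof.
move=> [mf hf]; split; first exact: measurable_funM.
by apply: eq_L1 (L1Z (c ^+ 2) hf) => z; rewrite exprMn.
Qed.

Lemma L2D f g : L2 f -> L2 g -> L2 (fun z => f z + g z).
Proof.
move=> hf hg; split; first by apply: measurable_funD; [case: hf|case: hg].
have h := L1D (L1D (proj2 hf) (L1Z 2 (L2M hf hg))) (proj2 hg).
apply: eq_L1 h => z; ring.
Qed.

Lemma L2_sum (I : Type) (s : seq I) (F : I -> T -> R) :
  (forall i, L2 (F i)) -> L2 (fun z => \sum_(i <- s) F i z).
Proof.
move=> hF; elim: s => [|a s ih].
  rewrite (_ : (fun z => _) = fun=> 0); first exact: L2_cst.
  by apply/funext => z; rewrite big_nil.
rewrite (_ : (fun z => _) = fun z => F a z + \sum_(i <- s) F i z); first exact: L2D.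
by apply/funext => z; rewrite big_cons.
Qed.

Lemma expect_sqr_eq0_ae f : L2 f -> expect P (fun z => f z ^+ 2) = 0 ->
  \forall z \ae P, f z = 0.
Proof.
move=> [mf hf] f0.
have mfE : measurable_fun setT (fun z => (f z ^+ 2)%:E).
  by apply/measurable_EFinP; exact: measurable_funX.
have /(ae_eq_integral_abs _ measurableT mfE) : (\int[P]_z `|(f z ^+ 2)%:E| = 0)%E.
  rewrite -[RHS](_ : (expect P (fun z => f z ^+ 2))%:E = 0%E); last by rewrite f0.
  rewrite -expectE//; apply: eq_integral => z _.
  by rewrite gee0_abs// lee_fin sqr_ge0.
by apply: filterS => z /(_ I) [] /eqP; rewrite sqrf_eq0 => /eqP.
Qed.

(** [f] vanishes almost everywhere, and the product with it, however large [g] is. Degenerate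
    directions are dispatched this way. *)
Lemma expect_ae0 f g : measurable_fun setT g -> L2 f ->
  expect P (fun z => f z ^+ 2) = 0 -> expect P (fun z => f z * g z) = 0.
Proof.
move=> mg hf f0; rewrite /expect (ae_eq_integral (cst 0%E))//=.
- by rewrite integral0.
- by apply/measurable_EFinP; apply: measurable_funM => //; case: hf.
by apply: filterS (expect_sqr_eq0_ae hf f0) => z fz0 _; rewrite fz0 mul0r.
Qed.

Lemma measure_neq0_eq0 f : L2 f -> expect P (fun z => f z ^+ 2) = 0 ->
  measurable [set z | f z != 0] /\ P [set z | f z != 0] = 0%E.
Proof.
move=> hf f0; have [mf _] := hf.
have mN : measurable [set z | f z != 0].
  rewrite (_ : [set z | _] = ~` [set z | f z ^+ 2 <= 0]); last first.
    apply/seteqP; split => z /=; first by rewrite exprn_even_le0//= => /eqP + /eqP.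
    by move=> /negP; rewrite exprn_even_le0.
  by apply: measurableC; apply: measurable_sublevel; exact: measurable_funX.
split=> //; apply: measure_negligible => //.
have [N [mN' PN sN]] := expect_sqr_eq0_ae hf f0.
by exists N; split => // z /= /eqP fz; apply: sN.
Qed.

End expectation.

(** * Concentration of sums of i.i.d. vectors *)

Section concentration.
Context {R : realType} {dT : measure_display} {T : measurableType dT}.
Variable P : probability T R.
Context {d : nat}.
Variable ze : T -> 'rV[R]_d.
Hypothesis ze2 : forall j, L2 P (fun z => ze z 0 j).

Definition mean_vec : 'rV[R]_d := \row_j expect P (fun z => ze z 0 j).

(** Second moments are not centred; the mean enters only through the linear term of [exp_proxy]. *)
Definition cov_form (t : 'rV[R]_d) : R := expect P (fun z => dotv t (ze z) ^+ 2).

Lemma L2_dotv t : L2 P (fun z => dotv t (ze z)).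
Proof. by apply: L2_sum => j; exact: L2Z. Qed.

Lemma expect_dotv t : expect P (fun z => dotv t (ze z)) = dotv t mean_vec.
Proof.
rewrite /dotv expect_sum => [|j]; last by apply: L1Z; exact: L2_L1.
by apply: eq_bigr => j _; rewrite mxE expectZ//; exact: L2_L1.
Qed.

Lemma cov_form_ge0 t : 0 <= cov_form t.
Proof. by apply: expect_ge0 => z; exact: sqr_ge0. Qed.

Lemma cov_formZ (s : R) a : cov_form (s *: a) = s ^+ 2 * cov_form a.
Proof.
rewrite /cov_form -expectZ; last by case: (L2_dotv a).
by apply: eq_expect => z; rewrite dotvZl exprMn.
Qed.

Lemma cov_formD u a (s : R) : cov_form (u + s *: a) =
  cov_form u + 2 * s * expect P (fun z => dotv u (ze z) * dotv a (ze z)) +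
  s ^+ 2 * cov_form a.
Proof.
have hu := L2_dotv u; have ha := L2_dotv a.
rewrite /cov_form -(expectZ (2 * s) (L2M hu ha)) -(expectZ (s ^+ 2) (proj2 ha)).
rewrite -expectD; [|by case: hu|exact/L1Z/L2M].
rewrite -expectD; [|by apply: L1D; [case: hu|exact/L1Z/L2M]|by apply: L1Z; case: ha].
by apply: eq_expect => z; rewrite dotvDl dotvZl; ring.
Qed.

Lemma cov_form_delta k : cov_form (delta_mx 0 k) = expect P (fun z => ze z 0 k ^+ 2).
Proof. by apply: eq_expect => z; rewrite dotv_deltal. Qed.

Context {dO : measure_display} {O : measurableType dO}.

Section fixed_sample.
Variables (Pr : probability O R) (n : nat) (Z : 'I_n -> O -> T).
Hypotheses (n0 : (0 < n)%N) (iidZ : iid_sample P Pr Z).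

(** Left unnormalised: division by [sqrt n] gives V of the overview, division by [n] the deviation
    of the empirical mean. *)
Definition sample_dev (w : O) : 'rV[R]_d :=
  \sum_i ze (Z i w) - n%:R *: mean_vec.

Lemma dotv_sample_dev t w : dotv t (sample_dev w) =
  \sum_i dotv t (ze (Z i w)) - n%:R * dotv t mean_vec.
Proof.
by rewrite dotvC dotvDl dotvNl dotvZl dotv_suml (dotvC _ t) (eq_bigr _ (fun i _ => dotvC _ _)).
Qed.

Definition scaled_dot t (z : T) : R := dotv t (ze z) / Num.sqrt n%:R.

(* Dominates [expR (dotv t x - cov_form t)], where [x] is the normalised deviation,
   whenever all increments are small, but has mean at most 1 under second moments only. *)
Definition exp_proxy t (w : O) : R :=
  expR (- (Num.sqrt n%:R * dotv t mean_vec) - cov_form t) *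
  \prod_i (1 + scaled_dot t (Z i w) + scaled_dot t (Z i w) ^+ 2).

Let sn0 : 0 < Num.sqrt n%:R :> R. Proof. by rewrite sqrtr_gt0 ltr0n. Qed.

Let quad_ge0 (y : R) : 0 <= 1 + y + y ^+ 2. Proof. by nra. Qed.

Lemma exp_proxy_ge0 t w : 0 <= exp_proxy t w.
Proof. by rewrite mulr_ge0 ?expR_ge0// prodr_ge0. Qed.

Lemma measurable_scaled_dot t : measurable_fun setT (scaled_dot t).
Proof. by apply: measurable_funM => //; case: (L2_dotv t). Qed.

Lemma measurable_quad_scaled_dot t :
  measurable_fun setT (fun z => 1 + scaled_dot t z + scaled_dot t z ^+ 2).
Proof.
apply: measurable_funD; last exact: measurable_funX (measurable_scaled_dot t).
by apply: measurable_funD => //; exact: measurable_scaled_dot.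
Qed.

Lemma measurable_exp_proxy t : measurable_fun setT (exp_proxy t).
Proof.
apply: measurable_funM => //; apply: measurable_bigprod => i.
apply: (measurableT_comp (measurable_quad_scaled_dot t)); by case: iidZ.
Qed.

(** Independence makes the mean of the product [c ^+ n], where [c - 1] collects the mean and second
    moment of one increment. The [n]-th power of [c <= exp (c - 1)] is exactly the inverse of the
    leading factor of [exp_proxy]. *)
Lemma exp_proxy_mean t : (\int[Pr]_w (exp_proxy t w)%:E <= 1)%E.
Proof.
have hL2 : L2 P (scaled_dot t).
  rewrite (_ : scaled_dot t = fun z => (Num.sqrt n%:R)^-1 * dotv t (ze z)).
    by apply: L2Z; exact: L2_dotv.
  by apply/funext => z; rewrite mulrC.
set s : R := Num.sqrt n%:R; have s0 : 0 < s := sn0.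
have s2 : s ^+ 2 = n%:R by rewrite sqr_sqrtr.
pose c := 1 + dotv t mean_vec / s + cov_form t / n%:R.
have hc : (\int[P]_z (1 + scaled_dot t z + scaled_dot t z ^+ 2)%:E = c%:E)%E.
  rewrite expectE; last first.
    by apply: L1D; [apply: L1D; [exact: L1_cst|exact: L2_L1]|case: hL2].
  rewrite expectD; [|by apply: L1D; [exact: L1_cst|exact: L2_L1]|by case: hL2].
  rewrite expectD; [|exact: L1_cst|exact: L2_L1].
  rewrite expect_cst; congr (_ + _ + _)%:E.
    rewrite (mulrC _ s^-1) -expect_dotv -expectZ; last exact/L2_L1/L2_dotv.
    by apply: eq_expect => z; rewrite mulrC.
  rewrite (mulrC _ n%:R^-1) -s2 -expectZ; last by case: (L2_dotv t).
  by apply: eq_expect => z; rewrite /scaled_dot exprMn exprVn mulrC.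
under eq_integral do rewrite EFinM.
rewrite ge0_integralZl//; last 2 first.
- apply/measurable_EFinP; apply: measurable_bigprod => i.
  by apply: (measurableT_comp (measurable_quad_scaled_dot t)); case: iidZ.
- by move=> w _; rewrite lee_fin prodr_ge0.
rewrite (iid_integral_prod iidZ (measurable_quad_scaled_dot t) _ hc)//.
rewrite -EFinM lee_fin.
have c0 : 0 <= c by rewrite -lee_fin -hc integral_ge0// => z _; rewrite lee_fin.
have cle : c <= expR (dotv t mean_vec / s + cov_form t / n%:R).
  by rewrite /c -addrA expR_ge1Dx.
rewrite [leRHS](_ : 1 = expR (- (s * dotv t mean_vec) - cov_form t) *
    expR (s * dotv t mean_vec + cov_form t)); last first.
  by rewrite -expRD -opprD addNr expR0.
rewrite ler_wpM2l ?expR_ge0//.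
have -> : s * dotv t mean_vec + cov_form t =
    n%:R * (dotv t mean_vec / s + cov_form t / n%:R).
  have nn0 : n%:R != 0 :> R by rewrite pnatr_eq0 -lt0n.
  by rewrite mulrDr [in X in _ = _ + X]mulrC divfK// -s2; field; rewrite gt_eqF.
by rewrite expRM_natl lerXn2r// nnegrE// expR_ge0.
Qed.

Lemma exp_proxy_ge t w : (forall i, `|scaled_dot t (Z i w)| <= 3^-1) ->
  expR (dotv t ((Num.sqrt n%:R)^-1 *: sample_dev w) - cov_form t) <= exp_proxy t w.
Proof.
move=> small; set s : R := Num.sqrt n%:R.
have s2 : s ^+ 2 = n%:R by rewrite sqr_sqrtr.
have -> : dotv t (s^-1 *: sample_dev w) - cov_form t =
    (- (s * dotv t mean_vec) - cov_form t) + \sum_i scaled_dot t (Z i w).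
  rewrite dotvZr dotv_sample_dev /scaled_dot -mulr_suml -/s.
  rewrite (_ : n%:R * _ = s ^+ 2 * dotv t mean_vec); last by rewrite s2.
  by field; rewrite gt_eqF.
rewrite expRD expR_sum ler_wpM2l ?expR_ge0//; apply: ler_prod => i _.
by rewrite expR_ge0/= expR_le_quadratic// (le_trans (ler_norm _)).
Qed.

Lemma measurable_sqnorm_sample_dev : measurable_fun setT (fun w => sqnorm (sample_dev w)).
Proof.
rewrite (_ : (fun w => _) = fun w => \sum_(j <- enum 'I_d) sample_dev w 0 j ^+ 2).
  apply: measurable_sum => j; apply: measurable_funX.
  rewrite (_ : (fun w => _) = fun w =>
    \sum_(i <- enum 'I_n) ze (Z i w) 0 j + - (n%:R * mean_vec 0 j)).
    apply: measurable_funD => //; apply: measurable_sum => i.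
    by apply: (measurableT_comp (proj1 (ze2 j))); case: iidZ.
  by apply/funext => w; rewrite /sample_dev !mxE summxE big_enum.
by apply/funext => w; rewrite sqnormE big_enum.
Qed.

End fixed_sample.
End concentration.

(** * Deviation bound with trace and operator norm separated *)

Section concentration_theorem.
Context {R : realType} {dT : measure_display} {T : measurableType dT}.
Variable P : probability T R.

Lemma integral_average_le1 (dO : measure_display) (O : measurableType dO)
    (Pr : probability O R) (I : Type) (s : seq I) (F : I -> O -> R) :
  (forall i, measurable_fun setT (F i)) -> (forall i w, 0 <= F i w) ->
  (forall i, (\int[Pr]_w (F i w)%:E <= 1)%E) ->
  (\int[Pr]_w ((size s)%:R^-1 * \sum_(i <- s) F i w)%:E <= 1)%E.
Proof.
move=> mF F0 F1.
under eq_integral do rewrite EFinM -sumEFin.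
rewrite ge0_integralZl//; last 2 first.
- by apply: emeasurable_sum => i; exact/measurable_EFinP.
- by move=> w _; apply: sume_ge0 => i _; rewrite lee_fin.
rewrite ge0_integral_sum//; last 2 first.
- by move=> i; exact/measurable_EFinP.
- by move=> i w _; rewrite lee_fin.
have h : (\sum_(i <- s) \int[Pr]_w (F i w)%:E <= (size s)%:R%:E)%E.
  elim: s => [|a s ih]; first by rewrite big_nil.
  by rewrite big_cons /= -natr1 addrC EFinD leeD.
apply: le_trans (lee_wpmul2l _ h) _; first by rewrite lee_fin invr_ge0.
rewrite -EFinM lee_fin; have [->|s0] := eqVneq (size s)%:R (0 : R).
  by rewrite mulr0.
by rewrite mulVf.
Qed.

Lemma vector_concentration (d : nat) (ze : T -> 'rV[R]_d) (A S eps : R) :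
  (forall j, L2 P (fun z => ze z 0 j)) -> 0 < S ->
  (forall t, cov_form P ze t <= S * sqnorm t) ->
  \sum_k expect P (fun z => ze z 0 k ^+ 2) <= A -> 0 < eps <= 1 ->
  exists N : nat, forall n, (N <= n)%N ->
  forall (dO : measure_display) (O : measurableType dO) (Pr : probability O R)
    (Z : 'I_n -> O -> T), iid_sample P Pr Z ->
  let E := [set w | sqnorm (sample_dev P ze Z w) <=
                    n%:R * (8 * A + 80 * S * ln (4 / eps))] in
  measurable E /\ ((1 - eps)%:E <= Pr E)%E.
Proof.
move=> ze2 S0 qS qA /andP[e0 e1].
have A0 : 0 <= A.
  by apply: le_trans qA; apply: sumr_ge0 => k _; apply: expect_ge0 => z; exact: sqr_ge0.
set L := ln (4 / eps).
have L0 : 0 <= L by rewrite ln_ge0// ler_pdivlMr//; lra.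
(* Solves [(r2 / 80 - A / 10) / S = L], so that the mixture is at least [4 / eps] on the sphere. *)
pose r2 : R := 8 * A + 80 * S * L.
have r20 : 0 <= r2 by rewrite addr_ge0 ?mulr_ge0// ltW.
have [ts [ts0 tsP]] : exists ts : seq 'rV[R]_d, (0 < size ts)%N /\
    forall x, sqnorm x = r2 -> expR ((r2 / 80 - A / 10) / S) <=
      (size ts)%:R^-1 * \sum_(t <- ts) expR (dotv t x - cov_form P ze t).
  apply: (sgn_mixture_exists (cov_formD ze2) (cov_formZ ze2) (cov_form_ge0 P ze)) => //.
  by under eq_bigr do rewrite cov_form_delta.
pose M2 : R := 1 + \sum_(t <- ts) sqnorm t.
have M20 : 0 < M2.
  by rewrite ltr_pwDl// sumr_ge0// => t _; exact: sqnorm_ge0.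
have tM2 t : t \in ts -> sqnorm t <= M2.
  move=> tts; rewrite /M2 (big_rem t)//= addrCA lerDl addr_ge0// sumr_ge0// => u _.
  exact: sqnorm_ge0.
have iW : L1 P (fun z => sqnorm (ze z)).
  apply: (eq_L1 (f := fun z => \sum_(j <- enum 'I_d) ze z 0 j ^+ 2)).
    by move=> z; rewrite big_enum sqnormE.
  by apply: L1_sum => j; case: (ze2 j).
have mW := L1_measurable iW.
(* [M2 * kappa = (1/3)^2]: outside [Bad1], Cauchy-Schwarz brings every increment below the threshold
   of [exp_proxy_ge]. *)
pose kappa : R := (9 * M2)^-1.
have k0 : 0 < kappa by rewrite invr_gt0 mulr_gt0.
have e20 : 0 < eps / 2 by lra.
have [N0 tail] := tail_measure_small iW (fun z => sqnorm_ge0 (ze z)) k0 e20.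
exists (maxn 1 N0) => n; rewrite geq_max => /andP[n0 nN] dO O Pr Z iidZ E.
have mE : measurable E.
  by apply: measurable_sublevel; exact: measurable_sqnorm_sample_dev iidZ.
split=> //.
pose B := [set z | kappa * n%:R < sqnorm (ze z)].
have mB : measurable B by exact: measurable_superlevel.
have [mBad1 PBad1] := iid_union_bound iidZ mB.
set Bad1 := \big[setU/set0]_i _ in mBad1 PBad1.
(* The opposite vectors are there because a deviation beyond the sphere will be shrunk by [rho], at
   the cost of both exponentials of [dotv t x] and its opposite. *)
pose us := ts ++ [seq - t | t <- ts].
pose G w := (size us)%:R^-1 * \sum_(t <- us) exp_proxy P ze Z t w.
have mG : measurable_fun setT G.
  apply: measurable_funM => //; apply: measurable_sum => t.
  by apply: measurable_exp_proxy => //; exact: iidZ.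
have G0 w : 0 <= G w.
  by rewrite mulr_ge0 ?invr_ge0// sumr_ge0// => t _; exact: exp_proxy_ge0.
have G1 : (\int[Pr]_w (G w)%:E <= 1)%E.
  apply: integral_average_le1 => [t|t w|t].
  - by apply: measurable_exp_proxy => //; exact: iidZ.
  - exact: exp_proxy_ge0.
  - by apply: exp_proxy_mean => //; exact: iidZ.
(* Since [us] is twice as long as [ts], the value [4 / eps] of the mixture yields only [2 / eps] for
   [G]; Markov's inequality then leaves [eps / 2] for [Bad1]. *)
pose Bad2 := [set w | 2 / eps <= G w].
have mBad2 : measurable Bad2.
  rewrite (_ : Bad2 = [set w | - G w <= - (2 / eps)]).
    by apply: measurable_sublevel; exact: measurable_funN.
  by apply/seteqP; split => w; rewrite /Bad2/= lerN2.
have PBad2 : (Pr Bad2 <= (eps / 2)%:E)%E.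
  have c0 : 0 < 2 / eps by rewrite divr_gt0.
  have := le_trans (markov_ge0 Pr mG G0 c0) G1.
  rewrite -/Bad2 -[Pr Bad2]fineK ?fin_num_measure// -EFinM !lee_fin.
  by rewrite mulrC -ler_pdivlMr// mul1r invf_div.
have sub : ~` E `<=` Bad1 `|` Bad2.
  move=> w /= /negP; rewrite -ltNge => bigV.
  have [?|nBad1] := pselect (Bad1 w); [by left|right].
  have Wsmall i : sqnorm (ze (Z i w)) <= kappa * n%:R.
    rewrite leNgt; apply/negP => Wi; apply: nBad1; rewrite /Bad1.
    by rewrite (bigD1 i)//=; left.
  set s : R := Num.sqrt n%:R.
  have s0 : 0 < s by rewrite sqrtr_gt0 ltr0n.
  have s2 : s ^+ 2 = n%:R by rewrite sqr_sqrtr.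
  have small t i : t \in ts -> `|scaled_dot ze n t (Z i w)| <= 3^-1.
    move=> tts; rewrite -[leRHS]ger0_norm// -ler_sqr ?nnegrE// !real_normK ?num_real//.
    rewrite /scaled_dot -/s exprMn exprVn s2 ler_pdivrMr ?ltr0n//.
    apply: le_trans (sqr_dotv_le _ _) _.
    apply: (@le_trans _ _ (M2 * (kappa * n%:R))).
      by apply: ler_pM => //; [exact: sqnorm_ge0|exact: sqnorm_ge0|exact: tM2].
    rewrite mulrA ler_wpM2r// /kappa le_eqVlt; apply/orP; left; apply/eqP.
    by field; rewrite gt_eqF.
  pose x := s^-1 *: sample_dev P ze Z w.
  have proxy t : t \in ts -> expR (dotv t x) + expR (- dotv t x) <=
      (exp_proxy P ze Z t w + exp_proxy P ze Z (- t) w) * expR (cov_form P ze t).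
    move=> tts.
    have qN : cov_form P ze (- t) = cov_form P ze t.
      by apply: eq_expect => z; rewrite dotvNl sqrrN.
    have h1 := exp_proxy_ge P n0 (fun i => small t i tts).
    have h2 : expR (dotv (- t) x - cov_form P ze t) <= exp_proxy P ze Z (- t) w.
      rewrite -qN; apply: (exp_proxy_ge P n0) => i.
      by rewrite /scaled_dot dotvNl mulNr normrN; exact: small.
    rewrite dotvNl in h2; rewrite expRB ler_pdivrMr ?expR_gt0// in h1.
    rewrite expRB ler_pdivrMr ?expR_gt0// in h2.
    by rewrite mulrDl lerD.
  have xr : r2 < sqnorm x.
    have -> : sqnorm x = n%:R^-1 * sqnorm (sample_dev P ze Z w).
      by rewrite /sqnorm /x dotvZl dotvZr mulrA -expr2 exprVn s2.
    by rewrite mulrC ltr_pdivlMr ?ltr0n// mulrC.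
  pose rho : R := Num.sqrt (r2 / sqnorm x).
  have x0 : 0 < sqnorm x by exact: le_lt_trans xr.
  have rho2 : rho ^+ 2 = r2 / sqnorm x by rewrite sqr_sqrtr// divr_ge0// ltW.
  have rho01 : 0 <= rho <= 1.
    rewrite sqrtr_ge0/= -ler_sqr ?nnegrE ?sqrtr_ge0// rho2 expr1n ler_pdivrMr//.
    by rewrite mul1r ltW.
  have xrho : sqnorm (rho *: x) = r2.
    by rewrite /sqnorm dotvZl dotvZr mulrA -expr2 rho2 divfK// gt_eqF.
  have := tsP _ xrho.
  have -> : (r2 / 80 - A / 10) / S = L by rewrite /r2; field; rewrite gt_eqF.
  rewrite /L lnK ?posrE ?divr_gt0// => h.
  have h2 : 4 / eps <= 2 * G w.
    apply: (le_trans h); rewrite /G /us size_cat size_map big_cat/= big_map.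
    have -> : 2 * ((size ts + size ts)%:R^-1 * (\sum_(t <- ts) exp_proxy P ze Z t w +
        \sum_(t <- ts) exp_proxy P ze Z (- t) w)) = (size ts)%:R^-1 *
        \sum_(t <- ts) (exp_proxy P ze Z t w + exp_proxy P ze Z (- t) w).
      rewrite big_split/= natrD -mulr2n -[X in X^-1]mulr_natl.
      by field; rewrite pnatr_eq0 -lt0n.
    rewrite ler_wpM2l ?invr_ge0// big_seq [leRHS]big_seq; apply: ler_sum => t tts.
    rewrite expRB ler_pdivrMr ?expR_gt0//.
    apply: le_trans (proxy t tts).
    by rewrite dotvZr; exact: expR_contract_le.
  rewrite /Bad2/=; lra.
have PC : (Pr (~` E) <= eps%:E)%E.
  apply: (@le_trans _ _ (Pr (Bad1 `|` Bad2))).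
    by apply: le_measure => //; rewrite inE; [exact: measurableC|exact: measurableU].
  apply: le_trans (measureU2 _ _ _) _ => //.
  rewrite (_ : eps = eps / 2 + eps / 2); last by field.
  rewrite EFinD; apply: leeD => //; apply: le_trans PBad1 _.
  exact: tail.
rewrite -(setCK E) probability_setC; last exact: measurableC.
by rewrite EFinB; apply: leeB.
Qed.

End concentration_theorem.

(** * Ridge regression in the eigenbasis of Q *)

Section orthogonal_coordinates.
Context {R : realType} {d : nat}.
Variable U : 'M[R]_d.
Hypothesis UU : U *m U^T = 1%:M.
Implicit Types u v w : 'rV[R]_d.

Lemma dotv_mulmx u v : dotv u v = (u *m v^T) 0 0.
Proof. by rewrite mxE; apply: eq_bigr => i _; rewrite mxE. Qed.

Lemma dotv_row u k : dotv u (row k U) = (u *m U^T) 0 k.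
Proof. by rewrite mxE; apply: eq_bigr => i _; rewrite !mxE. Qed.

Lemma dotv_row_row k l : dotv (row k U) (row l U) = (k == l)%:R.
Proof.
have := congr1 (fun M : 'M[R]_d => M k l) UU; rewrite !mxE => <-.
by apply: eq_bigr => i _; rewrite !mxE.
Qed.

Lemma parseval u v : dotv u v = \sum_k dotv u (row k U) * dotv v (row k U).
Proof.
have UTU : U^T *m U = 1%:M by exact: mulmx1C.
rewrite dotv_mulmx.
have -> : u *m v^T = (u *m U^T) *m (v *m U^T)^T.
  by rewrite trmx_mul trmxK mulmxA -[u *m U^T *m U]mulmxA UTU mulmx1.
by rewrite mxE; apply: eq_bigr => k _; rewrite !dotv_row mxE [(v *m _)^T _ _]mxE.
Qed.

Lemma sqnorm_mulmx u : sqnorm (u *m U) = sqnorm u.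
Proof.
by rewrite /sqnorm !dotv_mulmx trmx_mul mulmxA -[u *m U *m U^T]mulmxA UU mulmx1.
Qed.

End orthogonal_coordinates.

(** The map sending [r] to [g r + q r^2] is smallest at the end point [r = 1], so its left
    derivative there, [g + 2 q], is not positive. Were it [e > 0], the step [s] below would satisfy
    [q s <= e/2] and contradict minimality. *)
Lemma quadratic_segment_min (R : realType) (g q : R) : 0 <= q ->
  (forall s, 0 < s < 1 -> g + q <= g * (1 - s) + q * (1 - s) ^+ 2) -> g + 2 * q <= 0.
Proof.
move=> q0 h; rewrite leNgt; apply/negP => e0.
set e := g + 2 * q in e0; have eq0 : 0 < e + q by lra.
pose s : R := e / (2 * (e + q)).
have s0 : 0 < s by rewrite divr_gt0// mulr_gt0.
have s1 : s < 1 by rewrite ltr_pdivrMr ?mulr_gt0//; lra.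
have es : (e + q) * s = e / 2 by rewrite /s; field; rewrite gt_eqF.
have := h s; rewrite s0 s1 => /(_ isT) hs.
have : s * (e - q * s) <= 0 by rewrite /e; nra.
by rewrite pmulr_rle0// => ?; nra.
Qed.

Section ridge.
Context {R : realType} {d : nat} {dX : measure_display} {X : measurableType dX}.
Variables (P : probability (X * R)%type R) (phi : X -> 'rV[R]_d) (lam : R).
Variables (theta_t : 'rV[R]_d) (U : 'M[R]_d) (nu : 'rV[R]_d).
Hypothesis Y2 : L1 P (fun z => z.2 ^+ 2).
Hypothesis mphi : forall j, measurable_fun setT (fun x => phi x 0 j).
Hypothesis phi2 : forall j, L1 P (fun z => phi z.1 0 j ^+ 2).
Hypothesis lam0 : 0 <= lam.
Hypothesis phi4 : L1 P (fun z => sqnorm (phi z.1) ^+ 2).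
Hypothesis phixi : L1 P
  (fun z => sqnorm (phi z.1) * (f_lin phi theta_t z.1 - z.2) ^+ 2).
Hypothesis specQ : spectral_decomp (Qmat P phi) U nu.
Implicit Types u v w t : 'rV[R]_d.

Definition eig_coord k (x : X) : R := dotv (row k U) (phi x).

Definition isqrt_eig k : R := (Num.sqrt (nu 0 k + lam))^-1.

(* The coordinates of Q_lambda^{-1/2} phi(x) in the eigenbasis of Q. *)
Definition whitened (x : X) : 'rV[R]_d := \row_k (isqrt_eig k * eig_coord k x).

Definition resid (z : X * R) : R := f_lin phi theta_t z.1 - z.2.

(** Gradient at [theta_t] of half the squared loss, in whitened coordinates. Its mean need not
    vanish, because of the penalty and of the constraint. *)
Definition score (z : X * R) : 'rV[R]_d := resid z *: whitened z.1.

Let UU : U *m U^T = 1%:M. Proof. by case: specQ. Qed.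

Lemma L2_phi j : L2 P (fun z => phi z.1 0 j).
Proof. by split => //; exact: (measurableT_comp (mphi j) measurable_fst). Qed.

Lemma L2_dot_phi u : L2 P (fun z => dotv u (phi z.1)).
Proof. exact: (L2_dotv L2_phi). Qed.

Lemma measurable_dot_phi u : measurable_fun setT (fun x => dotv u (phi x)).
Proof.
rewrite (_ : (fun x => _) = fun x => \sum_(j <- enum 'I_d) u 0 j * phi x 0 j).
  by apply: measurable_sum => j; exact: measurable_funM.
by apply/funext => x; rewrite big_enum.
Qed.

Lemma L2_resid : L2 P resid.
Proof.
have hY : L2 P (fun z => z.2) by split => //; exact: measurable_snd.
rewrite (_ : resid = fun z => dotv theta_t (phi z.1) + -1 * z.2).
  by apply: L2D; [exact: L2_dot_phi|exact: L2Z].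
by apply/funext => z; rewrite mulN1r.
Qed.

Lemma Qmat_form u v : expect P (fun z => dotv u (phi z.1) * dotv v (phi z.1)) =
  (u *m Qmat P phi *m v^T) 0 0.
Proof.
have hij i j : L1 P (fun z => phi z.1 0 i * phi z.1 0 j) by apply: L2M; exact: L2_phi.
rewrite (eq_expect _ (g := fun z =>
    \sum_j \sum_i v 0 j * u 0 i * (phi z.1 0 i * phi z.1 0 j))); last first.
  move=> z; rewrite mulrC /dotv mulr_suml; apply: eq_bigr => j _.
  by rewrite mulr_sumr; apply: eq_bigr => i _; ring.
rewrite expect_sum => [|j]; last by apply: L1_sum => i; exact: L1Z.
rewrite mxE; apply: eq_bigr => j _.
rewrite expect_sum => [|i]; last exact: L1Z.
rewrite mxE mulr_suml; apply: eq_bigr => i _.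
by rewrite expectZ// !mxE; ring.
Qed.

Lemma eig_coord_cov k l :
  expect P (fun z => eig_coord k z.1 * eig_coord l z.1) = (k == l)%:R * nu 0 k.
Proof.
have [_ [QE _]] := specQ.
rewrite Qmat_form QE !rowE trmx_mul.
have -> : delta_mx 0 k *m U *m (U^T *m diag_mx nu *m U) *m (U^T *m (delta_mx 0 l)^T) =
    delta_mx 0 k *m diag_mx nu *m (delta_mx 0 l)^T :> 'M[R]_1.
  rewrite !mulmxA -(mulmxA _ U U^T) UU mulmx1.
  by rewrite -(mulmxA _ U U^T) UU mulmx1.
rewrite trmx_delta -rowE -colE !mxE mulr_natl; by case: eqP.
Qed.

Lemma eig_ge0 k : 0 <= nu 0 k.
Proof.
have := eig_coord_cov k k; rewrite eqxx mul1r => <-.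
by apply: expect_ge0 => z; rewrite -expr2 sqr_ge0.
Qed.

Let nl k : 0 <= nu 0 k + lam. Proof. by rewrite addr_ge0// eig_ge0. Qed.

Lemma isqrt_eig_sqr k : isqrt_eig k ^+ 2 = (nu 0 k + lam)^-1.
Proof. by rewrite exprVn sqr_sqrtr. Qed.

Lemma dotv_phiE u x :
  dotv u (phi x) = \sum_k dotv u (row k U) * eig_coord k x.
Proof. by rewrite (parseval UU); apply: eq_bigr => k _; rewrite (dotvC (phi x)). Qed.

(** The rows of [U] diagonalise the second moments of [phi] and the penalty simultaneously. *)
Lemma ridge_formE u : expect P (fun z => dotv u (phi z.1) ^+ 2) + lam * sqnorm u =
  \sum_k dotv u (row k U) ^+ 2 * (nu 0 k + lam).
Proof.
have hkl k l : L1 P (fun z => eig_coord k z.1 * eig_coord l z.1).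
  by apply: L2M; exact: L2_dot_phi.
have -> : sqnorm u = \sum_k dotv u (row k U) ^+ 2.
  by rewrite /sqnorm (parseval UU); apply: eq_bigr => k _; rewrite expr2.
rewrite (eq_expect _ (g := fun z => \sum_k \sum_l
    (dotv u (row k U) * dotv u (row l U)) * (eig_coord k z.1 * eig_coord l z.1))).
  rewrite expect_sum => [|k]; last by apply: L1_sum => l; exact: L1Z.
  rewrite mulr_sumr -big_split/=; apply: eq_bigr => k _.
  rewrite expect_sum => [|l]; last exact: L1Z.
  rewrite (bigD1 k)//= expectZ// eig_coord_cov eqxx mul1r big1 => [|l lk]; first by ring.
  by rewrite expectZ// eig_coord_cov eq_sym (negPf lk) mul0r mulr0.
move=> z; rewrite dotv_phiE expr2 mulr_suml; apply: eq_bigr => k _.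
by rewrite mulr_sumr; apply: eq_bigr => l _; ring.
Qed.

Lemma whitened_norm x : sqnorm (phi x *m Qlam_isqrt U nu lam) = sqnorm (whitened x).
Proof.
rewrite /Qlam_isqrt mulmxA (sqnorm_mulmx UU) mulmxA; congr sqnorm.
apply/rowP => k; rewrite mul_mx_diag !mxE mulrC; congr (_ * _).
by rewrite /eig_coord dotvC dotv_row mxE.
Qed.

Lemma expect_whitened_norm :
  expect P (fun z => sqnorm (phi z.1 *m Qlam_isqrt U nu lam)) = ridge_dim nu lam.
Proof.
rewrite (eq_expect _ (g := fun z => \sum_k isqrt_eig k ^+ 2 *
    (eig_coord k z.1 * eig_coord k z.1))); last first.
  move=> z; rewrite whitened_norm sqnormE; apply: eq_bigr => k _.
  by rewrite mxE; ring.
have hk k : L1 P (fun z => eig_coord k z.1 * eig_coord k z.1).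
  by apply: L2M; exact: L2_dot_phi.
rewrite expect_sum => [|k]; last exact: L1Z.
apply: eq_bigr => k _; rewrite expectZ// eig_coord_cov eqxx mul1r isqrt_eig_sqr.
(* A zero eigenvalue contributes 0 to both sides, even when [lam = 0]. *)
have := eig_ge0 k; rewrite le_eqVlt => /orP[/eqP <-|nk]; first by rewrite ltxx mulr0.
by rewrite nk mulrC.
Qed.

Lemma ridge_dim_ge0 : 0 <= ridge_dim nu lam.
Proof.
apply: sumr_ge0 => k _; case: ifP => // nk.
by rewrite divr_ge0// eig_ge0.
Qed.

Lemma eig_coord_sqr_le k x : eig_coord k x ^+ 2 <= sqnorm (phi x).
Proof.
apply: le_trans (sqr_dotv_le _ _) _.
by rewrite [sqnorm (row _ _)]/sqnorm (dotv_row_row UU) eqxx mul1r.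
Qed.

Lemma L2_whitened k : L2 P (fun z => whitened z.1 0 k).
Proof.
rewrite (_ : (fun z => _) = fun z => isqrt_eig k * eig_coord k z.1).
  by apply: L2Z; exact: L2_dot_phi.
by apply/funext => z; rewrite mxE.
Qed.

(** The rows of [U] are unit vectors, so each product is at most a constant times [|phi|^2]; this is
    where the fourth moment of [phi] enters. *)
Lemma L2_whitenedM k l : L2 P (fun z => whitened z.1 0 k * whitened z.1 0 l).
Proof.
have [mk _] := L2_whitened k; have [ml _] := L2_whitened l.
split; first exact: measurable_funM.
apply: (L1_le _ _ (L1Z (isqrt_eig k ^+ 2 * isqrt_eig l ^+ 2) phi4)).
  by apply: measurable_funX; exact: measurable_funM.
move=> z; rewrite ger0_norm ?sqr_ge0// !mxE.
rewrite [leLHS](_ : _ = isqrt_eig k ^+ 2 * isqrt_eig l ^+ 2 *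
  (eig_coord k z.1 ^+ 2 * eig_coord l z.1 ^+ 2)); last by ring.
apply: ler_wpM2l; first by rewrite mulr_ge0// sqr_ge0.
by rewrite expr2; apply: ler_pM; rewrite ?sqr_ge0// eig_coord_sqr_le.
Qed.

Lemma L2_score k : L2 P (fun z => score z 0 k).
Proof.
have [mk _] := L2_whitened k; have [mr _] := L2_resid.
rewrite (_ : (fun z => _) = fun z => resid z * whitened z.1 0 k); last first.
  by apply/funext => z; rewrite mxE.
split; first exact: measurable_funM.
apply: (L1_le _ _ (L1Z (isqrt_eig k ^+ 2) phixi)).
  by apply: measurable_funX; exact: measurable_funM.
move=> z; rewrite ger0_norm ?sqr_ge0// !mxE -/(resid z).
rewrite [leLHS](_ : _ = isqrt_eig k ^+ 2 * (eig_coord k z.1 ^+ 2 * resid z ^+ 2)); last by ring.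
apply: ler_wpM2l; first exact: sqr_ge0.
by rewrite ler_wpM2r ?sqr_ge0// eig_coord_sqr_le.
Qed.

Lemma expect_score_norm : \sum_k expect P (fun z => score z 0 k ^+ 2) =
  expect P (fun z => sqnorm (phi z.1 *m Qlam_isqrt U nu lam) *
                     (f_lin phi theta_t z.1 - z.2) ^+ 2).
Proof.
rewrite -expect_sum => [|k]; last by case: (L2_score k).
apply: eq_expect => z; rewrite whitened_norm sqnormE mulr_suml.
by apply: eq_bigr => k _; rewrite !mxE /resid; ring.
Qed.

(** The substitution [v = Q_lambda^{-1/2} t] turns a direction of the score into a direction of
    [phi], so the supremum of ratios controls the operator norm. The second clause is an inequality
    because coordinates of [t] with [nu + lam = 0] are lost. *)
Lemma score_cov_le t : exists v,
  cov_form P score t =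
    expect P (fun z => dotv v (phi z.1) ^+ 2 * (f_lin phi theta_t z.1 - z.2) ^+ 2) /\
  expect P (fun z => dotv v (phi z.1) ^+ 2) + lam * sqnorm v <= sqnorm t.
Proof.
pose v := \sum_k (t 0 k * isqrt_eig k) *: row k U.
exists v; split.
  apply: eq_expect => z; rewrite -exprMn -/(resid z); congr (_ ^+ 2).
  rewrite /v dotv_suml mulr_suml; apply: eq_bigr => k _.
  by rewrite dotvZl !mxE /eig_coord; ring.
rewrite ridge_formE sqnormE; apply: ler_sum => k _.
have -> : dotv v (row k U) = t 0 k * isqrt_eig k.
  rewrite /v dotv_suml (bigD1 k)//= dotvZl (dotv_row_row UU) eqxx mulr1 big1 ?addr0//.
  by move=> l lk; rewrite dotvZl (dotv_row_row UU) (negPf lk) mulr0.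
rewrite exprMn isqrt_eig_sqr -mulrA ler_piMr ?sqr_ge0//.
by have [->|h] := eqVneq (nu 0 k + lam) 0; rewrite ?mulr0// mulVf.
Qed.

Lemma null_direction (k : 'I_d) : nu 0 k + lam = 0 ->
  expect P (fun z => eig_coord k z.1 ^+ 2) = 0.
Proof.
move=> h; rewrite (eq_expect _ (g := fun z => eig_coord k z.1 * eig_coord k z.1)).
  rewrite eig_coord_cov eqxx mul1r; apply/eqP.
  have := paddr_eq0 (eig_ge0 k) lam0; rewrite h eqxx => /esym/andP[]//.
by move=> z; rewrite expr2.
Qed.

(** A ratio with zero denominator counts as 0 in the supremum; this is its honest value, the
    numerator being 0 as well. *)
Lemma ridge_ratio_num_eq0 v :
  expect P (fun z => dotv v (phi z.1) ^+ 2) + lam * sqnorm v = 0 ->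
  expect P (fun z => dotv v (phi z.1) ^+ 2 * (f_lin phi theta_t z.1 - z.2) ^+ 2) = 0.
Proof.
move=> h; have hv := L2_dot_phi v.
have q0 : expect P (fun z => dotv v (phi z.1) ^+ 2) = 0.
  have : 0 <= expect P (fun z => dotv v (phi z.1) ^+ 2).
    by apply: expect_ge0 => z; exact: sqr_ge0.
  have : 0 <= lam * sqnorm v by rewrite mulr_ge0// sqnorm_ge0.
  lra.
rewrite (eq_expect _ (g := fun z => dotv v (phi z.1) *
   (dotv v (phi z.1) * resid z ^+ 2))); last by move=> z; rewrite /resid; ring.
apply: expect_ae0 => //; apply: measurable_funM; first by case: hv.
by apply: measurable_funX; case: L2_resid.
Qed.

Lemma pop_objD u : pop_obj P phi lam (theta_t + u) = pop_obj P phi lam theta_t +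
  2 * (expect P (fun z => resid z * dotv u (phi z.1)) + lam * dotv theta_t u) +
  (expect P (fun z => dotv u (phi z.1) ^+ 2) + lam * sqnorm u).
Proof.
have hr := L2_resid; have hu := L2_dot_phi u.
rewrite /pop_obj (eq_expect _ (g := fun z =>
  (resid z ^+ 2 + 2 * (resid z * dotv u (phi z.1))) + dotv u (phi z.1) ^+ 2)); last first.
  by move=> z; rewrite /resid /f_lin dotvDl; ring.
rewrite expectD; last 2 first.
- by apply: L1D; [case: hr|exact/L1Z/L2M].
- by case: hu.
rewrite expectD; [|by case: hr|exact/L1Z/L2M].
rewrite expectZ; last exact: L2M.
have -> : expect P (fun z => (z.2 - f_lin phi theta_t z.1) ^+ 2) =
    expect P (fun z => resid z ^+ 2).
  by apply: eq_expect => z; rewrite /resid; ring.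
rewrite /sqnorm dotvDl !dotvDr (dotvC u theta_t); ring.
Qed.

Lemma emp_objD n (s : 'I_n -> X * R) u :
  emp_obj s phi lam (theta_t + u) = emp_obj s phi lam theta_t +
  2 * (n%:R^-1 * (\sum_i resid (s i) * dotv u (phi (s i).1)) + lam * dotv theta_t u) +
  (n%:R^-1 * (\sum_i dotv u (phi (s i).1) ^+ 2) + lam * sqnorm u).
Proof.
rewrite /emp_obj (eq_bigr (fun i => (resid (s i) ^+ 2 +
    2 * (resid (s i) * dotv u (phi (s i).1))) + dotv u (phi (s i).1) ^+ 2)).
  rewrite !big_split/= -mulr_sumr /sqnorm dotvDl !dotvDr (dotvC u theta_t) /resid; ring.
by move=> i _; rewrite /resid /f_lin dotvDl; ring.
Qed.

End ridge.

(** * Excess risk *)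

Lemma sqr_sum_pair (R : realType) (I : finType) (a : I -> R) :
  (\sum_k a k) ^+ 2 = \sum_(p : I * I) a p.1 * a p.2.
Proof.
rewrite expr2 mulr_suml; under eq_bigr do rewrite mulr_sumr.
by rewrite pair_bigA.
Qed.

Section excess_risk.
Context {R : realType} {d : nat} {dX : measure_display} {X : measurableType dX}.
Variables (P : probability (X * R)%type R) (phi : X -> 'rV[R]_d) (lam : R).
Variables (theta_t : 'rV[R]_d) (U : 'M[R]_d) (nu : 'rV[R]_d).
Hypothesis Y2 : L1 P (fun z => z.2 ^+ 2).
Hypothesis mphi : forall j, measurable_fun setT (fun x => phi x 0 j).
Hypothesis phi2 : forall j, L1 P (fun z => phi z.1 0 j ^+ 2).
Hypothesis lam0 : 0 <= lam.
Hypothesis specQ : spectral_decomp (Qmat P phi) U nu.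

Local Notation resid := (resid phi theta_t).
Local Notation eig_coord := (eig_coord phi U).
Local Notation whitened := (whitened phi lam U nu).
Local Notation score := (score phi lam theta_t U nu).

(** On the segment the objective is [2 g r + q r^2] up to a constant, and [quadratic_segment_min]
    yields [g + q <= 0]. Comparing only the end points would give half as much curvature,
    [g + q/2 <= 0]. *)
Lemma empirical_min_curvature (Theta : set 'rV[R]_d) n (s : 'I_n -> X * R) u :
  convex_set Theta -> Theta theta_t -> Theta (theta_t + u) ->
  (forall theta, Theta theta ->
    emp_obj s phi lam (theta_t + u) <= emp_obj s phi lam theta) ->
  (n%:R^-1 * (\sum_i resid (s i) * dotv u (phi (s i).1)) + lam * dotv theta_t u) +
  (n%:R^-1 * (\sum_i dotv u (phi (s i).1) ^+ 2) + lam * sqnorm u) <= 0.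
Proof.
move=> cvx Tt Th hmin; set g := _ + lam * dotv _ _; set q := _ + lam * sqnorm u.
have q0 : 0 <= q.
  rewrite addr_ge0 ?mulr_ge0 ?sqnorm_ge0 ?invr_ge0// sumr_ge0// => i _.
  exact: sqr_ge0.
suff : 2 * g + 2 * q <= 0 by lra.
apply: quadratic_segment_min => // r /andP[r0 r1].
have Tr : Theta (theta_t + (1 - r) *: u).
  have := cvx theta_t (theta_t + u) (Itv01 (ltW r0) (ltW r1)).
  rewrite !inE => /(_ Tt Th).
  have -> // : theta_t + (1 - r) *: u = r *: theta_t + (1 - r) *: (theta_t + u).
  by rewrite scalerDr addrA -scalerDl subrKC scale1r.
have := hmin _ Tr; rewrite !emp_objD.
have -> : n%:R^-1 * (\sum_i resid (s i) * dotv ((1 - r) *: u) (phi (s i).1)) +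
    lam * dotv theta_t ((1 - r) *: u) = (1 - r) * g.
  under eq_bigr do rewrite dotvZl mulrCA.
  rewrite -mulr_sumr dotvZr /g; ring.
have -> : n%:R^-1 * (\sum_i dotv ((1 - r) *: u) (phi (s i).1) ^+ 2) +
    lam * sqnorm ((1 - r) *: u) = (1 - r) ^+ 2 * q.
  under eq_bigr do rewrite dotvZl exprMn.
  rewrite -mulr_sumr /q /sqnorm dotvZl dotvZr; ring.
rewrite -/g -/q; lra.
Qed.

Lemma whitened_cov k l : expect P (fun z => whitened z.1 0 k * whitened z.1 0 l) =
  (k == l)%:R * (nu 0 k * (nu 0 k + lam)^-1).
Proof.
rewrite (eq_expect _ (g := fun z => isqrt_eig lam nu k * isqrt_eig lam nu l *
    (eig_coord k z.1 * eig_coord l z.1))); last by move=> z; rewrite !mxE; ring.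
rewrite expectZ; last by apply: L2M; exact: L2_dot_phi.
rewrite (eig_coord_cov mphi phi2 specQ).
have [<-|_] := eqVneq k l; last by rewrite !mul0r mulr0.
by rewrite !mul1r -expr2 (isqrt_eig_sqr mphi phi2 lam0 specQ) mulrC.
Qed.

(** Write [g] and [q] for linear and quadratic parts, with index P or n for population or sample.
    The excess is [2 g_P + q_P], optimality gives [g_n + q_n <= 0], and the penalty cancels in
    [g_P - g_n]. From [q_n >= 3/4 q_P] and [2 (g_P - g_n) <= q_P/2 + 2 |dv|^2] the coefficient of
    [q_P] becomes [1 - 3/2 + 1/2 = 0]; hence the threshold [1/16 = (1/4)^2]. *)
Lemma excess_risk_le (Theta : set 'rV[R]_d) n (s : 'I_n -> X * R) theta_h :
  convex_set Theta -> Theta theta_t -> Theta theta_h ->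
  (forall theta, Theta theta ->
    emp_obj s phi lam theta_h <= emp_obj s phi lam theta) ->
  (forall k i, nu 0 k + lam = 0 -> eig_coord k (s i).1 = 0) ->
  \sum_(p : 'I_d * 'I_d)
    (n%:R^-1 * (\sum_i whitened (s i).1 0 p.1 * whitened (s i).1 0 p.2) -
     expect P (fun z => whitened z.1 0 p.1 * whitened z.1 0 p.2)) ^+ 2 <= 16^-1 ->
  pop_obj P phi lam theta_h <= pop_obj P phi lam theta_t +
    2 * \sum_k (n%:R^-1 * (\sum_i score (s i) 0 k) - expect P (fun z => score z 0 k)) ^+ 2.
Proof.
move=> cvx Tt Th hmin null covd.
pose u := theta_h - theta_t; have thE : theta_h = theta_t + u by rewrite subrKC.
rewrite thE in Th hmin *.
have curv := empirical_min_curvature cvx Tt Th hmin.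
rewrite pop_objD// -addrA lerD2l.
have eig0 := eig_ge0 mphi phi2 specQ.
have nl k : 0 <= nu 0 k + lam by rewrite addr_ge0.
pose c k := dotv u (row k U).
pose b k := c k * Num.sqrt (nu 0 k + lam).
have b2 k : b k ^+ 2 = c k ^+ 2 * (nu 0 k + lam) by rewrite exprMn sqr_sqrtr.
have sq0 k : Num.sqrt (nu 0 k + lam) = 0 -> nu 0 k + lam = 0.
  by move=> /eqP; rewrite sqrtr_eq0 => h; apply/eqP; rewrite eq_le h nl.
have UU : U *m U^T = 1%:M by case: specQ.
(* Where [nu 0 k + lam = 0] the whitened coordinate is 0 by convention, so the expansion is right
   only because [null] makes [eig_coord k] vanish at the sample points. *)
have expand i : dotv u (phi (s i).1) = \sum_k b k * whitened (s i).1 0 k.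
  rewrite (dotv_phiE specQ); apply: eq_bigr => k _.
  rewrite mxE /b /isqrt_eig -/(c k).
  have [h|h] := eqVneq (Num.sqrt (nu 0 k + lam)) 0.
    by rewrite (null k i (sq0 k h)) !mulr0.
  by rewrite -mulrA mulVKf.
have hre k : L1 P (fun z => resid z * eig_coord k z.1).
  by apply: L2M; [exact: L2_resid|exact: L2_dot_phi].
have expectg : expect P (fun z => resid z * dotv u (phi z.1)) =
    \sum_k b k * expect P (fun z => score z 0 k).
  rewrite (eq_expect _ (g := fun z => \sum_k c k * (resid z * eig_coord k z.1))).
    rewrite expect_sum => [|k]; last exact: L1Z.
    apply: eq_bigr => k _; rewrite expectZ//.
    rewrite [in RHS](eq_expect _ (g := fun z =>
      isqrt_eig lam nu k * (resid z * eig_coord k z.1))).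
      rewrite expectZ// /b /isqrt_eig.
      have [h|h] := eqVneq (Num.sqrt (nu 0 k + lam)) 0.
        rewrite h invr0 mul0r !mulr0.
        rewrite (eq_expect _ (g := fun z => eig_coord k z.1 * resid z)).
          rewrite expect_ae0 ?mulr0//; [by case: (L2_resid theta_t Y2 mphi phi2)| |].
            exact: L2_dot_phi.
          exact: (null_direction mphi phi2 lam0 specQ) (sq0 _ h).
        by move=> z; rewrite mulrC.
      by rewrite -mulrA mulVKf.
    by move=> z; rewrite !mxE; ring.
  move=> z; rewrite (dotv_phiE specQ) mulr_sumr; apply: eq_bigr => k _.
  by rewrite -/(c k); ring.
have sqn : sqnorm u = \sum_k c k ^+ 2.
  by rewrite /sqnorm (parseval UU); apply: eq_bigr => k _; rewrite expr2.
pose m (p : 'I_d * 'I_d) := expect P (fun z => whitened z.1 0 p.1 * whitened z.1 0 p.2).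
pose mn (p : 'I_d * 'I_d) :=
  n%:R^-1 * (\sum_i whitened (s i).1 0 p.1 * whitened (s i).1 0 p.2).
set qP := expect P (fun z => dotv u (phi z.1) ^+ 2) + lam * sqnorm u.
have qPb : qP = \sum_k b k ^+ 2.
  rewrite /qP (ridge_formE _ mphi phi2 specQ).
  by apply: eq_bigr => k _; rewrite b2.
(* The penalty is kept apart so that [qP] and [qn] differ only through the matrices [m] and [mn]. *)
have qPm : qP = \sum_p b p.1 * b p.2 * m p + lam * sqnorm u.
  rewrite qPb sqn mulr_sumr.
  rewrite -(pair_bigA _ (fun k l => b k * b l * m (k, l)))/= -big_split/=.
  apply: eq_bigr => k _; rewrite (bigD1 k)//= big1 ?addr0; last first.
    by move=> l lk; rewrite /m whitened_cov eq_sym (negPf lk) mul0r mulr0.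
  rewrite /m whitened_cov eqxx mul1r -expr2 b2.
  have [h|h] := eqVneq (nu 0 k + lam) 0; last by field.
  have /andP[_ /eqP l0] : (nu 0 k == 0) && (lam == 0).
    by rewrite -paddr_eq0// h.
  by rewrite h mulr0 mul0r add0r l0 mul0r.
set qn := n%:R^-1 * (\sum_i dotv u (phi (s i).1) ^+ 2) + lam * sqnorm u in curv *.
have qnm : qn = \sum_p b p.1 * b p.2 * mn p + lam * sqnorm u.
  rewrite /qn; congr (_ + _); under eq_bigr do rewrite expand sqr_sum_pair.
  rewrite exchange_big/= mulr_sumr; apply: eq_bigr => p _.
  rewrite /mn [RHS]mulrCA; congr (_ * _); rewrite mulr_sumr.
  by apply: eq_bigr => i _; ring.
have qP0 : 0 <= qP by rewrite qPb sumr_ge0// => k _; exact: sqr_ge0.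
(* Cauchy-Schwarz over pairs of indices: the squared Frobenius norm of the rank-one matrix [b^T b]
   is [qP ^+ 2]. *)
have qdiff : 3 / 4 * qP <= qn.
  have cs := cauchy_schwarz (fun p : 'I_d * 'I_d => b p.1 * b p.2) (fun p => mn p - m p).
  have bb : \sum_(p : 'I_d * 'I_d) (b p.1 * b p.2) ^+ 2 = qP ^+ 2.
    rewrite qPb sqr_sum_pair; by apply: eq_bigr => p _; rewrite exprMn.
  have dE : qn - qP = \sum_p (b p.1 * b p.2) * (mn p - m p).
    rewrite qnm qPm opprD addrACA subrr addr0 -sumrB; by apply: eq_bigr => p _; rewrite mulrBr.
  rewrite -dE bb in cs.
  have {}cs : (qn - qP) ^+ 2 <= (qP / 4) ^+ 2.
    apply: le_trans cs _; rewrite exprMn ler_wpM2l ?sqr_ge0//.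
    by apply: le_trans covd _; rewrite le_eqVlt; apply/orP; left; apply/eqP; field.
  have : `|qn - qP| <= qP / 4.
    rewrite -[leRHS]ger0_norm ?divr_ge0//.
    by rewrite -ler_sqr ?nnegrE// !real_normK ?num_real.
  rewrite ler_norml => /andP[h _]; lra.
pose dv k := n%:R^-1 * (\sum_i score (s i) 0 k) - expect P (fun z => score z 0 k).
have gdiff : n%:R^-1 * (\sum_i resid (s i) * dotv u (phi (s i).1)) -
    expect P (fun z => resid z * dotv u (phi z.1)) = \sum_k b k * dv k.
  rewrite expectg -sumrN.
  have -> : n%:R^-1 * (\sum_i resid (s i) * dotv u (phi (s i).1)) =
      \sum_k b k * (n%:R^-1 * (\sum_i score (s i) 0 k)).
    under eq_bigr do rewrite expand mulr_sumr.
    rewrite exchange_big/= mulr_sumr; apply: eq_bigr => k _.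
    rewrite [RHS]mulrCA; congr (_ * _); rewrite mulr_sumr.
    by apply: eq_bigr => i _; rewrite !mxE; ring.
  by rewrite -big_split/=; apply: eq_bigr => k _; rewrite /dv mulrBr.
have amgm : - (2 * \sum_k b k * dv k) <= qP / 2 + 2 * \sum_k dv k ^+ 2.
  rewrite qPb mulr_suml !mulr_sumr -big_split/= -sumrN; apply: ler_sum => k _.
  rewrite -subr_ge0 [X in 0 <= X](_ : _ = 2 * (b k / 2 + dv k) ^+ 2); last by field.
  by rewrite mulr_ge0// sqr_ge0.
rewrite -/(dv _) in amgm *; lra.
Qed.

End excess_risk.

(** * Weak law of large numbers and degenerate variances *)

Section concentration_corollaries.
Context {R : realType} {dT : measure_display} {T : measurableType dT}.
Variable P : probability T R.

Lemma sqnorm_sample_dev (d : nat) (ze : T -> 'rV[R]_d) (dO : measure_display)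
    (O : measurableType dO) n (Z : 'I_n -> O -> T) w :
  sqnorm (sample_dev P ze Z w) =
  \sum_k (\sum_i ze (Z i w) 0 k - n%:R * expect P (fun z => ze z 0 k)) ^+ 2.
Proof. by rewrite sqnormE; apply: eq_bigr => k _; rewrite !mxE summxE. Qed.

Lemma cov_form_le_trace (d : nat) (ze : T -> 'rV[R]_d) t :
  (forall j, L2 P (fun z => ze z 0 j)) ->
  cov_form P ze t <= (\sum_k expect P (fun z => ze z 0 k ^+ 2)) * sqnorm t.
Proof.
move=> ze2; have h k : L1 P (fun z => ze z 0 k ^+ 2) by case: (ze2 k).
rewrite -expect_sum// mulrC -expectZ; last exact: L1_sum.
apply: le_expect; first by case: (L2_dotv ze2 t).
  by apply: L1Z; exact: L1_sum.
by move=> z; rewrite -sqnormE; exact: sqr_dotv_le.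
Qed.

(** A deviation bound linear in [n] is eventually below [n^2 delta]. The trace plus one serves as
    operator bound, which keeps it positive. *)
Lemma weak_law (d : nat) (ze : T -> 'rV[R]_d) (eps delta : R) :
  (forall j, L2 P (fun z => ze z 0 j)) -> 0 < eps <= 1 -> 0 < delta ->
  exists N : nat, forall n, (N <= n)%N ->
  forall (dO : measure_display) (O : measurableType dO) (Pr : probability O R)
    (Z : 'I_n -> O -> T), iid_sample P Pr Z ->
  exists E : set O, [/\ measurable E, ((1 - eps)%:E <= Pr E)%E &
    forall w, E w -> sqnorm (sample_dev P ze Z w) <= n%:R ^+ 2 * delta].
Proof.
move=> ze2 eps01 delta0.
pose A := \sum_k expect P (fun z => ze z 0 k ^+ 2).
have A0 : 0 <= A.
  by apply: sumr_ge0 => k _; apply: expect_ge0 => z; exact: sqr_ge0.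
have S0 : 0 < A + 1 by lra.
have hS t : cov_form P ze t <= (A + 1) * sqnorm t.
  by apply: le_trans (cov_form_le_trace t ze2) _; rewrite ler_wpM2r ?sqnorm_ge0// lerDl.
have [N hN] := vector_concentration ze2 S0 hS (lexx A) eps01.
pose C : R := 8 * A + 80 * (A + 1) * ln (4 / eps).
exists (maxn N (Num.bound (`|C| / delta))) => n; rewrite geq_max => /andP[Nn Cn].
move=> dO O Pr Z iidZ; have [mE PE] := hN n Nn _ _ Pr Z iidZ.
eexists; split; [exact: mE|exact: PE|] => w /= /le_trans; apply.
rewrite expr2 -[leRHS]mulrA ler_wpM2l// (le_trans (ler_norm _))// -ler_pdivrMr//.
rewrite (le_trans (ltW (archi_boundP _)))// ?ler_nat//.
by rewrite divr_ge0// ltW.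
Qed.

Lemma iid_almost_surely_zero (I : finType) (f : I -> T -> R) :
  (forall i, L2 P (f i)) -> (forall i, expect P (fun z => f i z ^+ 2) = 0) ->
  forall n (dO : measure_display) (O : measurableType dO) (Pr : probability O R)
    (Z : 'I_n -> O -> T), iid_sample P Pr Z ->
  exists E : set O, [/\ measurable E, Pr E = 1%E & forall w, E w ->
    forall i j, f j (Z i w) = 0].
Proof.
move=> hf f0 n dO O Pr Z iidZ.
pose B := \big[setU/set0]_j [set z | f j z != 0].
have [mB PB] : measurable B /\ P B = 0%E.
  rewrite /B; elim/big_rec: _ => [|j B' _ [mB' PB']]; first by rewrite measure0.
  have [mj Pj] := measure_neq0_eq0 (hf j) (f0 j).
  split; first exact: measurableU.
  apply/eqP; rewrite eq_le measure_ge0 andbT.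
  apply: (@le_trans _ _ (P [set z | f j z != 0]%R + P B')%E).
    exact: measureU2.
  by rewrite Pj PB' adde0.
have [mU PU] := iid_union_bound iidZ mB.
exists (~` (\big[setU/set0]_i (Z i @^-1` B))); split.
- exact: measurableC.
- rewrite probability_setC//; rewrite PB mule0 in PU.
  have -> : Pr (\big[setU/set0]_i (Z i @^-1` B)) = 0%E.
    by apply/eqP; rewrite eq_le PU measure_ge0.
  by rewrite sube0.
- move=> w nw i j; apply/eqP/negP => fj; apply: nw.
  rewrite (bigD1 i)//=; left; rewrite /B /= (bigD1 j)//=; left; exact/negP.
Qed.

(** [S = 0] escapes the mixture argument, whose variance is [1/(10 S)]; but then all coordinates
    vanish almost surely and so does the deviation. *)
Lemma vector_concentration_ge0 (d : nat) (ze : T -> 'rV[R]_d) (A S eps : R) :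
  (forall j, L2 P (fun z => ze z 0 j)) -> 0 <= S ->
  (forall t, cov_form P ze t <= S * sqnorm t) ->
  \sum_k expect P (fun z => ze z 0 k ^+ 2) <= A -> 0 < eps <= 1 ->
  exists N : nat, forall n, (N <= n)%N ->
  forall (dO : measure_display) (O : measurableType dO) (Pr : probability O R)
    (Z : 'I_n -> O -> T), iid_sample P Pr Z ->
  exists E : set O, [/\ measurable E, ((1 - eps)%:E <= Pr E)%E &
    forall w, E w -> sqnorm (sample_dev P ze Z w) <=
                     n%:R * (8 * A + 80 * S * ln (4 / eps))].
Proof.
move=> ze2; rewrite le_eqVlt => /orP[/eqP <-|S0] hS hA eps01; last first.
  have [N hN] := vector_concentration ze2 S0 hS hA eps01.
  exists N => n Nn dO O Pr Z iidZ; have [mE PE] := hN n Nn _ _ Pr Z iidZ.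
  by eexists; split; [exact: mE|exact: PE|].
have z0 k : expect P (fun z => ze z 0 k ^+ 2) = 0.
  have := hS (delta_mx 0 k); rewrite cov_form_delta mul0r => h.
  by apply/eqP; rewrite eq_le h expect_ge0// => z; exact: sqr_ge0.
have A0 : 0 <= A by apply: le_trans hA; rewrite big1.
have [e0 e1] := andP eps01.
exists 0 => n _ dO O Pr Z iidZ.
have [E [mE PE hE]] := iid_almost_surely_zero ze2 z0 iidZ.
exists E; split => //; first by rewrite PE lee_fin; lra.
move=> w Ew; rewrite sqnorm_sample_dev// big1; last first.
  move=> k _; rewrite big1 => [|i _]; last exact: hE.
  rewrite (eq_expect _ (g := fun z => ze z 0 k * 1)); last by move=> z; rewrite mulr1.
  by rewrite expect_ae0 ?z0// mulr0 subrr expr0n.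
by rewrite mulr0 mul0r addr0 !mulr_ge0.
Qed.

End concentration_corollaries.

(** [h] and [g] have equal integrals over cylinders, so they are interchangeable against nonnegative
    functions of the first coordinate; [g] is then replaced by its essential supremum. *)
Lemma cond_exp_X_le (R : realType) (dX : measure_display) (X : measurableType dX)
    (P : probability (X * R)%type R) (h : X * R -> R) (g : X -> \bar R) (k : X -> R)
    (s2 : R) :
  measurable_fun setT h -> (forall z, 0 <= h z) -> cond_exp_X P h g ->
  (forall x, (0 <= g x)%E) -> ess_sup P (fun z => g z.1) = s2%:E ->
  measurable_fun setT k -> (forall x, 0 <= k x) ->
  L1 P (fun z => k z.1 * h z) -> L1 P (fun z => k z.1) ->
  expect P (fun z => k z.1 * h z) <= s2 * expect P (fun z => k z.1).
Proof.
move=> mh h0 [mg gE] g0 hs mk k0 ikh ik.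
have mg1 : measurable_fun setT (fun z : X * R => g z.1).
  exact: (measurableT_comp mg measurable_fst).
have mk1 : measurable_fun setT (fun z : X * R => (k z.1)%:E).
  by apply/measurable_EFinP; exact: (measurableT_comp mk measurable_fst).
have s20 : 0 <= s2.
  rewrite -lee_fin -hs; apply: ess_sup_gee; last by apply: aeW => z; exact: g0.
  by rewrite [X in (_ < X)%E]probability_setT.
rewrite -(expectZ s2 ik) -lee_fin -expectE// -expectE; last exact: L1Z.
have -> : (\int[P]_z (k z.1 * h z)%:E = \int[P]_z (g z.1 * (k z.1)%:E))%E.
  transitivity (\int[P]_z ((h z)%:E * (EFin \o k) z.1))%E.
    by apply: eq_integral => z _; rewrite -EFinM mulrC.
  apply: (ge0_integralM_transfer (h := EFin \o k) (Z1 := fst) (Z2 := fst)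
    (f1 := EFin \o h) (f2 := fun z => g z.1)) => //.
  - exact/measurable_EFinP.
  - move=> A mA; rewrite (_ : fst @^-1` A = A `*` [set: R]).
      by rewrite gE.
    by apply/seteqP; split => z //= [].
  - exact/measurable_EFinP.
apply: ae_ge0_le_integral => //.
- by move=> z _; rewrite mule_ge0// lee_fin.
- exact: emeasurable_funM.
- by move=> z _; rewrite lee_fin mulr_ge0.
- by apply/measurable_EFinP; exact: L1_measurable (L1Z s2 ik).
- have := @ess_sup_ge _ _ _ P (fun z => g z.1); rewrite hs.
  by apply: filterS => z gz _; rewrite EFinM lee_wpmul2r// lee_fin.
Qed.

(** * High-probability bound and comparison with the conditional variance *)

Section main_bounds.
Context {R : realType} {d : nat} {dX : measure_display} {X : measurableType dX}.
Variables (P : probability (X * R)%type R) (phi : X -> 'rV[R]_d) (lam : R).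
Variables (theta_t : 'rV[R]_d) (U : 'M[R]_d) (nu : 'rV[R]_d).
Hypothesis Y2 : L1 P (fun z => z.2 ^+ 2).
Hypothesis mphi : forall j, measurable_fun setT (fun x => phi x 0 j).
Hypothesis phi2 : forall j, L1 P (fun z => phi z.1 0 j ^+ 2).
Hypothesis lam0 : 0 <= lam.
Hypothesis phi4 : L1 P (fun z => sqnorm (phi z.1) ^+ 2).
Hypothesis phixi : L1 P
  (fun z => sqnorm (phi z.1) * (f_lin phi theta_t z.1 - z.2) ^+ 2).
Hypothesis specQ : spectral_decomp (Qmat P phi) U nu.

Local Notation resid := (resid phi theta_t).
Local Notation whitened := (whitened phi lam U nu).
Local Notation score := (score phi lam theta_t U nu).
Local Notation Ql := (Qlam_isqrt U nu lam).
Local Notation D := (ridge_dim nu lam).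
Local Notation A := (expect P
  (fun z => sqnorm (phi z.1 *m Ql) * (f_lin phi theta_t z.1 - z.2) ^+ 2)).
Local Notation B := (expect P (fun z => sqnorm (phi z.1 *m Ql))).
Local Notation num v := (expect P (fun z => dotv v (phi z.1) ^+ 2
                                    * (f_lin phi theta_t z.1 - z.2) ^+ 2)).
Local Notation den v := (expect P (fun z => dotv v (phi z.1) ^+ 2) + lam * sqnorm v).
Local Notation S := (ereal_sup [set (num v / den v)%:E | v in [set: 'rV[R]_d]]).

Lemma den_ge0 v : 0 <= den v.
Proof.
by rewrite addr_ge0 ?mulr_ge0 ?sqnorm_ge0// expect_ge0// => z; exact: sqr_ge0.
Qed.

Lemma ratio_sup_ge0 : (0 <= S)%E.
Proof.
apply: ereal_sup_ubound; exists 0 => //.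
by rewrite /sqnorm !dot0v mulr0 addr0 (eq_expect _ (g := fun=> 0)) ?expect_cst ?mul0r// =>
  z; rewrite dot0v expr0n mul0r.
Qed.

(** Covers [A / B * D] when [B = D = 0]: division by zero returns 0, which is indeed [A], since all
    eigenvalues of Q vanish. *)
Lemma score_energy_eq0 : D = 0 -> A = 0.
Proof.
have eig0 := eig_ge0 mphi phi2 specQ.
move=> D0; rewrite -(expect_score_norm lam Y2 mphi phi2 phixi specQ) big1// => k _.
have nk : nu 0 k = 0.
  apply/eqP; rewrite eq_le eig0 andbT leNgt; apply/negP => nk.
  have dk i : true -> 0 <= if 0 < nu 0 i then nu 0 i / (nu 0 i + lam) else 0.
    by move=> _; case: ifP => // ni; rewrite divr_ge0 ?addr_ge0.
  move: D0; rewrite /ridge_dim => /(psumr_eq0P dk)/(_ k isT); rewrite nk => /eqP; rewrite gt_eqF// divr_gt0//.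
  by rewrite ltr_pwDl.
rewrite (eq_expect _ (g := fun z => eig_coord phi U k z.1 *
  (isqrt_eig lam nu k ^+ 2 * (resid z ^+ 2 * eig_coord phi U k z.1)))); last first.
  by move=> z; rewrite !mxE; ring.
have hk := L2_dot_phi mphi phi2 (row k U).
apply: expect_ae0 => //.
  apply: measurable_funM => //; apply: measurable_funM; last by case: hk.
  by apply: measurable_funX; case: (L2_resid theta_t Y2 mphi phi2).
rewrite (eq_expect _ (g := fun z => eig_coord phi U k z.1 * eig_coord phi U k z.1)).
  by rewrite (eig_coord_cov mphi phi2 specQ) nk mulr0.
by move=> z; rewrite expr2.
Qed.

Lemma ridge_dim_ratio : A / B * D = A.
Proof.
rewrite (expect_whitened_norm mphi phi2 lam0 specQ).
have [D0|D0] := eqVneq D 0; first by rewrite D0 mulr0 score_energy_eq0.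
by rewrite divfK.
Qed.

(** Listing the matrix entries as one vector indexed by pairs turns the Frobenius norm into the
    Euclidean norm of [weak_law]. *)
Lemma whitened_cov_weak_law (eps : R) : 0 < eps <= 1 ->
  exists N : nat, forall n, (N <= n)%N -> (0 < n)%N ->
  forall (dO : measure_display) (O : measurableType dO) (Pr : probability O R)
    (Z : 'I_n -> O -> (X * R)%type), iid_sample P Pr Z ->
  exists E : set O, [/\ measurable E, ((1 - eps)%:E <= Pr E)%E & forall w, E w ->
    \sum_(p : 'I_d * 'I_d)
    (n%:R^-1 * (\sum_i whitened (Z i w).1 0 p.1 * whitened (Z i w).1 0 p.2) -
     expect P (fun z => whitened z.1 0 p.1 * whitened z.1 0 p.2)) ^+ 2 <= 16^-1].
Proof.
move=> eps01.
pose ze (z : X * R) : 'rV[R]_#|{: 'I_d * 'I_d}| :=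
  \row_j (whitened z.1 0 (enum_val j).1 * whitened z.1 0 (enum_val j).2).
have ze2 j : L2 P (fun z => ze z 0 j).
  rewrite (_ : (fun z => _) = fun z => whitened z.1 0 (enum_val j).1 *
    whitened z.1 0 (enum_val j).2); first exact: L2_whitenedM.
  by apply/funext => z; rewrite mxE.
have d0 : 0 < 16^-1 :> R by rewrite invr_gt0.
have [N hN] := weak_law ze2 eps01 d0.
exists N => n Nn n0 dO O Pr Z iidZ.
have [E [mE PE hE]] := hN n Nn _ _ Pr Z iidZ.
exists E; split => // w Ew.
have nn0 : 0 < n%:R :> R by rewrite ltr0n.
have := hE w Ew; rewrite sqnorm_sample_dev mulrC -ler_pdivrMr ?exprn_gt0//.
apply: le_trans; rewrite mulr_suml.
rewrite (reindex _ (onW_bij _ (@enum_val_bij _)))/=; apply: ler_sum => j _.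
set e := enum_val j.
have -> : \sum_i ze (Z i w) 0 j = \sum_i whitened (Z i w).1 0 e.1 * whitened (Z i w).1 0 e.2.
  by apply: eq_bigr => i _; rewrite mxE.
have -> : expect P (fun z => ze z 0 j) =
    expect P (fun z => whitened z.1 0 e.1 * whitened z.1 0 e.2).
  by apply: eq_expect => z; rewrite mxE.
rewrite le_eqVlt; apply/orP; left; apply/eqP; field.
by rewrite gt_eqF.
Qed.

(** The event is fixed before [theta_h], so that it serves all empirical minimisers at once. *)
Lemma excess_concentration (Theta : set 'rV[R]_d) (sS eps : R) :
  convex_set Theta -> Theta theta_t -> S = sS%:E -> 0 < eps < 1 ->
  exists N : nat, forall n, (0 < n)%N -> (N <= n)%N ->
  forall (dO : measure_display) (O : measurableType dO) (Pr : probability O R)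
    (Z : 'I_n -> O -> (X * R)%type), iid_sample P Pr Z ->
  exists E : set O, [/\ measurable E, ((1 - eps)%:E <= Pr E)%E & forall w, E w ->
    forall theta_h, Theta theta_h ->
    (forall theta, Theta theta -> emp_obj (fun i => Z i w) phi lam theta_h <=
                                  emp_obj (fun i => Z i w) phi lam theta) ->
    pop_obj P phi lam theta_h <= pop_obj P phi lam theta_t +
      30 * A / n%:R + 1000 * sS * (ln (3 * eps^-1) / n%:R)].
Proof.
move=> cvx Tt SE /andP[e0 e1].
have s0 : 0 <= sS by rewrite -lee_fin -SE ratio_sup_ge0.
(* Two events cost [eps / 3] each; the one about degenerate directions has full probability. *)
have e3 : 0 < eps / 3 <= 1 by apply/andP; split; lra.
have score2 := L2_score lam Y2 mphi phi2 phixi specQ.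
have hS t : cov_form P score t <= sS * sqnorm t.
  have [v [-> hv]] := score_cov_le theta_t mphi phi2 lam0 specQ t.
  apply: (@le_trans _ _ (sS * den v)); last by rewrite ler_wpM2l.
  have [dv0|dv0] := eqVneq (den v) 0.
    by rewrite dv0 mulr0 (ridge_ratio_num_eq0 theta_t Y2 mphi phi2 lam0 dv0).
  rewrite -ler_pdivrMr ?lt_neqAle ?(eq_sym 0) ?dv0 ?den_ge0//.
  by rewrite -lee_fin -SE; apply: ereal_sup_ubound; exists v.
have hA : \sum_k expect P (fun z => score z 0 k ^+ 2) <= A.
  by rewrite (expect_score_norm lam Y2 mphi phi2 phixi specQ).
have A0 : 0 <= A.
  apply: le_trans hA; apply: sumr_ge0 => k _; apply: expect_ge0 => z.
  exact: sqr_ge0.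
have [N1 hN1] := vector_concentration_ge0 score2 s0 hS hA e3.
have [N2 hN2] := whitened_cov_weak_law e3.
(* The boolean factor switches off the nondegenerate indices, so that one almost sure event handles
   all degenerate ones. *)
pose f0 (k : 'I_d) (z : X * R) : R :=
  (nu 0 k + lam == 0)%:R * eig_coord phi U k z.1.
have f02 k : L2 P (f0 k) by apply: L2Z; exact: L2_dot_phi.
have f00 k : expect P (fun z => f0 k z ^+ 2) = 0.
  have hk := L2_dot_phi mphi phi2 (row k U).
  rewrite (eq_expect _ (g := fun z => (nu 0 k + lam == 0)%:R *
    eig_coord phi U k z.1 ^+ 2)); last first.
    by move=> z; rewrite /f0; case: eqP; rewrite ?mul1r// !mul0r expr0n.
  rewrite expectZ; last by case: hk.
  case: eqP => [h|_]; last by rewrite mul0r.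
  by rewrite (null_direction mphi phi2 lam0 specQ h) mulr0.
exists (maxn N1 N2) => n n0; rewrite geq_max => /andP[nN1 nN2] dO O Pr Z iidZ.
have [E1 [mE1 PE1 hE1]] := hN1 n nN1 _ _ Pr Z iidZ.
have [E2 [mE2 PE2 hE2]] := hN2 n nN2 n0 _ _ Pr Z iidZ.
have [E3 [mE3 PE3 hE3]] := iid_almost_surely_zero f02 f00 iidZ.
have mE : measurable (E1 `&` E2 `&` E3).
  by apply: measurableI => //; exact: measurableI.
exists (E1 `&` E2 `&` E3); split => //.
- have PC F r : measurable F -> ((1 - r)%:E <= Pr F)%E -> (Pr (~` F) <= r%:E)%E.
    move=> mF; rewrite probability_setC// -[Pr F]fineK ?fin_num_measure//.
    by rewrite -EFinB !lee_fin; lra.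
  rewrite -(setCK (E1 `&` E2 `&` E3)) probability_setC; last exact: measurableC.
  rewrite EFinB; apply: leeB => //; rewrite !setCI.
  apply: (@le_trans _ _ (Pr (~` E1) + Pr (~` E2) + Pr (~` E3))%E).
    apply: le_trans (measureU2 _ _ _) _; [|exact: measurableC|].
      by apply: measurableU; exact: measurableC.
    by apply: leeD => //; apply: measureU2; exact: measurableC.
  apply: (@le_trans _ _ ((eps / 3)%:E + (eps / 3)%:E + 0%:E)%E).
    apply: leeD; first by apply: leeD; exact: PC.
    by apply: PC => //; rewrite subr0 PE3.
  by rewrite -!EFinD lee_fin; lra.
move=> w [[E1w E2w] E3w] theta_h Th hmin.
have nn0 : 0 < n%:R :> R by rewrite ltr0n.
have null k i : nu 0 k + lam = 0 -> eig_coord phi U k (Z i w).1 = 0.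
  by move=> h; have := hE3 w E3w i k; rewrite /f0 h eqxx mul1r.
have := excess_risk_le Y2 mphi phi2 lam0 specQ cvx Tt Th hmin null (hE2 w E2w).
move=> /le_trans; apply; rewrite -[leRHS]addrA lerD2l.
have := hE1 w E1w; rewrite sqnorm_sample_dev => dev.
have -> : \sum_k (n%:R^-1 * (\sum_i score (Z i w) 0 k) -
    expect P (fun z => score z 0 k)) ^+ 2 = n%:R ^- 2 *
    \sum_k (\sum_i score (Z i w) 0 k - n%:R * expect P (fun z => score z 0 k)) ^+ 2.
  by rewrite mulr_sumr; apply: eq_bigr => k _; field; rewrite gt_eqF.
(* [12 / eps <= (3 / eps)^3] because [eps < 1]. *)
have lnle : ln (4 / (eps / 3)) <= 3 * ln (3 * eps^-1).
  have i1 : 1 < eps^-1 by rewrite invf_gt1.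
  have -> : 3 * ln (3 * eps^-1) = ln ((3 * eps^-1) ^+ 3).
    have p3 : 0 < 3 * eps^-1 by rewrite mulr_gt0// invr_gt0.
    by rewrite [RHS]lnXn// [LHS]mulr_natl.
  rewrite ler_ln ?posrE ?exprn_gt0 ?divr_gt0 ?mulr_gt0 ?invr_gt0//.
  have -> : 4 / (eps / 3) = 12 * eps^-1 by field; rewrite gt_eqF.
  nra.
set L := ln (3 * eps^-1) in lnle *.
set L' := ln (4 / (eps / 3)) in lnle dev *.
have L0 : 0 <= L by rewrite ln_ge0// ler_pdivlMr//; lra.
have h1 : 80 * sS * L' <= 240 * sS * L by nra.
have h2 : n%:R ^- 2 * (n%:R * (8 * A + 80 * sS * L')) = (8 * A + 80 * sS * L') / n%:R.
  by field; rewrite gt_eqF.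
have h3 : n%:R ^- 2 * (\sum_k (\sum_i score (Z i w) 0 k -
    n%:R * expect P (fun z => score z 0 k)) ^+ 2) <= (8 * A + 80 * sS * L') / n%:R.
  by rewrite -h2 ler_wpM2l// invr_ge0 sqr_ge0.
(* Doubling gives at most [16 A + 480 sS L], within the announced 30 and 1000. *)
apply: le_trans (ler_wpM2l _ h3) _ => //.
have -> : 30 * A / n%:R + 1000 * sS * (L / n%:R) = (30 * A + 1000 * sS * L) / n%:R.
  by field; rewrite gt_eqF.
rewrite mulrA ler_wpM2r ?invr_ge0//.
have : 0 <= sS * L by rewrite mulr_ge0.
lra.
Qed.
Section conditional_variance.
Variables (g : X -> \bar R) (s2 : R).
Hypothesis gP : cond_exp_X P (fun z => (z.2 - f_lin phi theta_t z.1) ^+ 2) g.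
Hypothesis g0 : forall x, (0 <= g x)%E.
Hypothesis gs2 : ess_sup P (fun z => g z.1) = s2%:E.

Let mh : measurable_fun setT (fun z : X * R => (z.2 - f_lin phi theta_t z.1) ^+ 2).
Proof.
have [mr _] := L2_resid theta_t Y2 mphi phi2.
rewrite (_ : (fun z => _) = fun z => resid z ^+ 2); first exact: measurable_funX.
by apply/funext => z; rewrite /resid; ring.
Qed.

Lemma weighted_resid_le (k : X -> R) : measurable_fun setT k -> (forall x, 0 <= k x) ->
  L1 P (fun z => k z.1 * (f_lin phi theta_t z.1 - z.2) ^+ 2) -> L1 P (fun z => k z.1) ->
  expect P (fun z => k z.1 * (f_lin phi theta_t z.1 - z.2) ^+ 2) <=
  s2 * expect P (fun z => k z.1).
Proof.
move=> mk k0 ikh ik.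
have e z : k z.1 * (f_lin phi theta_t z.1 - z.2) ^+ 2 =
  k z.1 * (z.2 - f_lin phi theta_t z.1) ^+ 2 by ring.
rewrite (eq_expect _ e); apply: (cond_exp_X_le mh) gP g0 gs2 mk k0 _ ik.
  by move=> z; exact: sqr_ge0.
exact: eq_L1 e ikh.
Qed.

Lemma score_energy_le : A <= s2 * B.
Proof.
have wE x : sqnorm (phi x *m Ql) = \sum_(k <- enum 'I_d) whitened x 0 k ^+ 2.
  by rewrite (whitened_norm lam specQ) sqnormE big_enum.
apply: (weighted_resid_le (k := fun x => sqnorm (phi x *m Ql))).
- rewrite (funext wE); apply: measurable_sum => k; apply: measurable_funX.
  rewrite (_ : (fun x => _) = fun x => isqrt_eig lam nu k * dotv (row k U) (phi x)).
    by apply: measurable_funM => //; exact: measurable_dot_phi.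
  by apply/funext => x; rewrite mxE.
- by move=> x; exact: sqnorm_ge0.
- apply: (eq_L1 (f := fun z => \sum_(k <- enum 'I_d) score z 0 k ^+ 2)).
    move=> z; rewrite wE mulr_suml; apply: eq_bigr => k _; rewrite !mxE /resid; ring.
  by apply: L1_sum => k; case: (L2_score lam Y2 mphi phi2 phixi specQ k).
- apply: (eq_L1 (f := fun z => \sum_(k <- enum 'I_d) whitened z.1 0 k ^+ 2)).
    by move=> z; rewrite wE.
  by apply: L1_sum => k; case: (L2_whitened lam U nu mphi phi2 k).
Qed.

(** Conditioning with weight [dotv v (phi x) ^+ 2] bounds the numerator by [s2] times the
    unpenalised part of the denominator. *)
Lemma ratio_sup_le : (S <= s2%:E)%E.
Proof.
have s20 : 0 <= s2.
  rewrite -lee_fin -gs2; apply: ess_sup_gee; last by apply: aeW => z; exact: g0.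
  by rewrite [X in (_ < X)%E]probability_setT.
apply: ub_ereal_sup => _ [v _ <-]; rewrite lee_fin.
have hv := L2_dot_phi mphi phi2 v.
have mv := measurable_dot_phi mphi v.
have [mr _] := L2_resid theta_t Y2 mphi phi2.
have le1 : num v <= s2 * expect P (fun z => dotv v (phi z.1) ^+ 2).
  apply: (weighted_resid_le (k := fun x => dotv v (phi x) ^+ 2)).
  - exact: measurable_funX.
  - by move=> x; exact: sqr_ge0.
  - apply: (L1_le _ _ (L1Z (sqnorm v) phixi)).
      by apply: measurable_funM; apply: measurable_funX => //; case: hv.
    move=> z /=; rewrite (ger0_norm (mulr_ge0 (sqr_ge0 _) (sqr_ge0 _))) [leRHS]mulrA.
    by rewrite ler_wpM2r ?sqr_ge0// sqr_dotv_le.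
  - by case: hv.
have [dv0|dv0] := eqVneq (den v) 0; first by rewrite dv0 invr0 mulr0.
rewrite ler_pdivrMr ?lt_neqAle ?(eq_sym 0) ?dv0 ?den_ge0//.
by apply: le_trans le1 _; rewrite ler_wpM2l// lerDl mulr_ge0// sqnorm_ge0.
Qed.

End conditional_variance.
End main_bounds.

(** * Assembly of the two inequalities *)

Lemma inf_image_min (R : realType) (T : Type) (D : set T) (f : T -> R) x0 :
  D x0 -> (forall x, D x -> f x0 <= f x) -> inf [set f x | x in D] = f x0.
Proof.
move=> Dx0 fmin; apply/eqP; rewrite eq_le; apply/andP; split.
  apply: ge_inf; last by exists x0.
  by exists (f x0) => _ [x Dx <-]; exact: fmin.
apply: lb_le_inf; first by exists (f x0), x0.
by move=> _ [x Dx <-]; exact: fmin.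
Qed.

Lemma bound_coef_gt0 (R : realType) (D L n : R) : 0 <= D -> 0 < L -> 0 < n ->
  0 < (30 * D + 1000 * L) / n.
Proof. by move=> D0 L0 n0; apply: divr_gt0; [lra|exact: n0]. Qed.

Lemma risk_bound_le (R : realType) (A B D s sS L n m : R) :
  0 < n -> 0 < L -> A / B * D = A -> A <= s * D -> sS <= s ->
  m + 30 * A / B * D / n + 1000 * sS * (L / n) <= m + s * ((30 * D + 1000 * L) / n).
Proof.
move=> n0 L0 ABD AD Ss; rewrite -addrA lerD2l.
have -> : 30 * A / B * D / n = 30 * A / n by rewrite -{2}ABD; ring.
have -> : 30 * A / n + 1000 * sS * (L / n) = (30 * A + 1000 * (sS * L)) / n.
  by field; rewrite gt_eqF.
have h : sS * L <= s * L by rewrite ler_pM2r.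
rewrite [leRHS]mulrA; apply: ler_wpM2r; [by rewrite invr_ge0 ltW|lra].
Qed.

Theorem theorem2p1 (R : realType) (d : nat) (dX : measure_display)
  (X : measurableType dX) (P : probability (X * R)%type R)
  (phi : X -> 'rV[R]_d) (Theta : set 'rV[R]_d) (lam : R)
  (theta_t : 'rV[R]_d) (U : 'M[R]_d) (nu : 'rV[R]_d) (g : X -> \bar R) :
  (* Y is square integrable *)
  P.-integrable setT (fun z => (z.2 ^+ 2)%:E) ->
  (* phi_1, ..., phi_d are square integrable w.r.t. the law of X *)
  (forall j, measurable_fun setT (fun x => phi x 0 j)) ->
  (forall j, P.-integrable setT (fun z => (phi z.1 0 j ^+ 2)%:E)) ->
  (* Theta closed convex, lambda >= 0 *)
  closed Theta -> convex_set Theta -> 0 <= lam ->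
  (* theta_t (= tilde theta) minimizes R(f_theta) + lambda ||theta||^2 on Theta *)
  Theta theta_t ->
  (forall theta, Theta theta -> pop_obj P phi lam theta_t <= pop_obj P phi lam theta) ->
  (* moment assumptions *)
  P.-integrable setT (fun z => (sqnorm (phi z.1) ^+ 2)%:E) ->
  P.-integrable setT
    (fun z => (sqnorm (phi z.1) * (f_lin phi theta_t z.1 - z.2) ^+ 2)%:E) ->
  (* eigen-decomposition of Q = E[phi(X) phi(X)^T], nu_1 >= ... >= nu_d *)
  spectral_decomp (Qmat P phi) U nu ->
  (* g is a (nonnegative) version of E[(Y - tilde f(X))^2 | X] *)
  cond_exp_X P (fun z => (z.2 - f_lin phi theta_t z.1) ^+ 2) g ->
  (forall x, (0 <= g x)%E) ->
  let Ql := Qlam_isqrt U nu lam in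
  let D := ridge_dim nu lam in
  let minval := inf [set pop_obj P phi lam theta | theta in Theta] in
  let A := expect P
    (fun z => sqnorm (phi z.1 *m Ql) * (f_lin phi theta_t z.1 - z.2) ^+ 2) in
  let B := expect P (fun z => sqnorm (phi z.1 *m Ql)) in
  let S := ereal_sup [set ((expect P (fun z => dotv v (phi z.1) ^+ 2
                                       * (f_lin phi theta_t z.1 - z.2) ^+ 2))
                            / (expect P (fun z => dotv v (phi z.1) ^+ 2)
                               + lam * sqnorm v))%:E | v in [set: 'rV[R]_d]] in
  let sigma2 := ess_sup P (fun z => g z.1) in
  forall eps : R, 0 < eps ->
  exists n_eps : nat, forall n : nat, (2 <= n)%N -> (n_eps <= n)%N ->
  forall (dO : measure_display) (O : measurableType dO) (Pr : probability O R)
         (Z : 'I_n -> O -> (X * R)%type),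
  iid_sample P Pr Z ->
  forall theta_h : O -> 'rV[R]_d,
  (forall w, Theta (theta_h w) /\
     forall theta, Theta theta ->
       emp_obj (fun i => Z i w) phi lam (theta_h w)
       <= emp_obj (fun i => Z i w) phi lam theta) ->
  exists E : set O, measurable E /\ ((1 - eps)%:E <= Pr E)%E /\
  forall w, E w ->
    ((pop_obj P phi lam (theta_h w))%:E
       <= (minval + 30 * A / B * D / n%:R)%:E
          + 1000%:E * S * (ln (3 * eps^-1) / n%:R)%:E
     /\ (minval + 30 * A / B * D / n%:R)%:E
          + 1000%:E * S * (ln (3 * eps^-1) / n%:R)%:E
        <= minval%:E
          + sigma2 * ((30 * D + 1000 * ln (3 * eps^-1)) / n%:R)%:E)%E.
Proof.
move=> Y2 mphi phi2 _ cvx lam0 Tt tmin phi4 phixi specQ gP g0 Ql D minval A B S sigma2.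
move=> eps e0.
(* For [eps >= 1] the empty event qualifies. Afterwards [3 / eps > 1], so the logarithm is positive,
   which the infinite cases below rely on. *)
have [e1|e1] := leP 1 eps.
  exists 0%N => n _ _ dO O Pr Z iidZ theta_h hmin; exists set0; split => //.
  by split => //; rewrite measure0 lee_fin subr_le0.
have mvE : minval = pop_obj P phi lam theta_t by exact: inf_image_min.
have S0 : (0 <= S)%E by exact: ratio_sup_ge0.
have D0 : 0 <= D by exact: (ridge_dim_ge0 mphi phi2 lam0 specQ).
have BD : B = D by exact: (expect_whitened_norm mphi phi2 lam0 specQ).
have ABD : A / B * D = A by exact: (ridge_dim_ratio Y2 mphi phi2 lam0 phixi specQ).
set L := ln (3 * eps^-1).
have L0 : 0 < L.
  by rewrite ln_gt0// ltr_pdivlMr// mul1r; lra.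
have second n : (2 <= n)%N -> ((minval + 30 * A / B * D / n%:R)%:E
          + 1000%:E * S * (L / n%:R)%:E
        <= minval%:E + sigma2 * ((30 * D + 1000 * L) / n%:R)%:E)%E.
  move=> n2; have n0 : 0 < n%:R :> R by rewrite ltr0n; case: n n2.
  have c0 := bound_coef_gt0 D0 L0 n0.
  have s20 : (0 <= sigma2)%E.
    apply: ess_sup_gee; last by apply: aeW => z; exact: g0.
    by rewrite [X in (_ < X)%E]probability_setT.
  (* An infinite [sigma2] has a positive coefficient, so the right-hand side is infinite. *)
  case: (ltgtP sigma2 +oo%E) (leey sigma2) => // [s2fin|s2y] _; last first.
    by rewrite s2y gt0_mulye ?lte_fin// addey// leey.
  have s2E : sigma2 = (fine sigma2)%:E by rewrite fineK// ge0_fin_numE.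
  have AB : A <= fine sigma2 * B.
    have := score_energy_le lam Y2 mphi phi2 phixi specQ gP g0 s2E.
    by [].
  have SS : (S <= (fine sigma2)%:E)%E.
    exact: (ratio_sup_le Y2 mphi phi2 lam0 phixi gP g0 s2E).
  have Sfin : S \is a fin_num by rewrite ge0_fin_numE// (le_lt_trans SS)// ltry.
  rewrite -(fineK Sfin) lee_fin in SS.
  rewrite BD in AB.
  rewrite -(fineK Sfin) s2E -!EFinM -!EFinD lee_fin.
  exact: risk_bound_le.
(* An infinite supremum makes the middle expression infinite; the whole space then serves as
   event. *)
have [Sy|Sy] := eqVneq S +oo%E.
  exists 0%N => n n2 _ dO O Pr Z iidZ theta_h hmin; exists setT; split => //.
  have n0 : 0 < n%:R :> R by rewrite ltr0n; case: n n2 {Z iidZ hmin}.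
  split; first by rewrite probability_setT lee_fin; lra.
  move=> w _; split; last exact: second.
  have k1 : (0 < 1000%:E :> \bar R)%E by rewrite lte_fin ltr0n.
  have k2 : (0 < (L / n%:R)%:E)%E by rewrite lte_fin; exact: divr_gt0.
  rewrite Sy (gt0_muley k1) (gt0_mulye k2) addey; first exact: leey.
  by [].
have Sfin : S \is a fin_num by rewrite ge0_fin_numE// ltey.
have e01 : 0 < eps < 1 by rewrite e0.
have [N hN] := excess_concentration Y2 mphi phi2 lam0 phi4 phixi specQ cvx Tt
  (esym (fineK Sfin)) e01.
exists N => n n2 Nn dO O Pr Z iidZ theta_h hmin.
have [E [mE PE hE]] := hN n (ltnW n2) Nn _ _ Pr Z iidZ.
exists E; split => //; split => // w Ew; split; last exact: second.
have [Th hm] := hmin w.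
have := hE w Ew _ Th hm.
rewrite -(fineK Sfin) -!EFinM -!EFinD lee_fin mvE => /le_trans; apply.
suff -> : 30 * A / n%:R = 30 * A / B * D / n%:R by [].
by rewrite -{1}ABD !mulrA.
Qed.
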